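(* Let $f:N\to E^4$ be an immersion of an oriented surface. (1) Suppose $f$ is minimal and there exists a compatible complex structure $\hat J\in\mathcal J^+$ (respectively, $\hat J\in\mathcal J^-$) such that $f$ is slant with respect to $\hat J$. Then (1-a) for any $\alpha\in[0,\pi]$ there is a compatible complex structure $J_\alpha\in\mathcal J^+$ (respectively, $J_\alpha\in\mathcal J^-$) such that $f$ is $\alpha$-slant with respect to $J_\alpha$; (1-b) $f$ is slant with respect to every complex structure $J\in\mathcal J^+$ (respectively, $J\in\mathcal J^-$). (2) If $f$ is non-minimal, then there exist at most two complex structures $\pm J^+\in\mathcal J^+$ and at most two complex structures $\pm J^-\in\mathcal J^-$ such that $f$ is slant with respect to them.
   Context: Surfaces are smooth and connected. $E^4$ is oriented Euclidean $4$-space. $\mathcal J$ is the set of compatible complex structures: linear $J:E^4\to E^4$ with $J^2=-I$ and $\langle JX,JY\rangle=\langle X,Y\rangle$. A $J$-basis is an orthonormal basis $e_1,\dots,e_4$ with $Je_1=e_2$, $Je_3=e_4$; $\mathcal J^+$ (resp. $\mathcal J^-$) is the set of $J\in\mathcal J$ whose $J$-bases are positive (resp. negative). For an oriented $2$-plane $V$ with positive orthonormal basis $e_1,e_2$ put $\alpha_J(V)=\cos^{-1}\langle Je_1,e_2\rangle\in[0,\pi]$. $f$ is $\alpha$-slant with respect to $J$ if $\alpha_J(T_pN)=\alpha$ for all $p\in N$, and slant with respect to $J$ if it is $\alpha$-slant for some constant $\alpha\in[0,\pi]$. Minimal means the mean curvature vector vanishes identically; non-minimal means not minimal. *)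

(* Defs.v *)
From HB Require Import structures.
From mathcomp Require Import all_boot all_order all_algebra.
From mathcomp Require Import all_classical all_reals all_analysis.
From mathcomp Require Import ring.
Set Implicit Arguments.
Unset Strict Implicit.
Unset Printing Implicit Defensive.
Import Order.TTheory GRing.Theory Num.Theory.
Import numFieldNormedType.Exports.
Local Open Scope classical_set_scope.
Local Open Scope ring_scope.

(* Points and vectors of R^n are row vectors 'rV[R]_n.  Linear endomorphisms
   are matrices acting on the right: J(X) is X *m J.  The library norm of 'rV
   is the sup norm, which yields the same topology and differentials as the
   Euclidean one; Euclidean geometry is expressed through [dotp]. *)

Definition dotp (R : realType) (n : nat) (X Y : 'rV[R]_n) : R :=
  (X *m Y^T) 0 0.

Definition orthonormal_rows (R : realType) (m n : nat) (E : 'M[R]_(m, n)) :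
    Prop :=
  forall i j, dotp (row i E) (row j E) = (i == j)%:R.

(* C^infinity: every iterated directional derivative of g (s lists the
   directions) is differentiable at every point of U, U being open in all
   uses. *)
Definition smooth_on (R : realType) (m n : nat) (U : set 'rV[R]_m)
    (g : 'rV[R]_m -> 'rV[R]_n) : Prop :=
  forall (s : seq 'rV[R]_m) (x : 'rV[R]_m), U x ->
    differentiable (foldr (fun v (h : 'rV[R]_m -> 'rV[R]_n) => 'D_v h) g s) x.

Record chart (R : realType) (N : topologicalType) := Chart {
  chart_dom : set N;
  chart_map : N -> 'rV[R]_2;
  chart_inv : 'rV[R]_2 -> N;
  chart_dom_open : open chart_dom;
  chart_cod_open : open (chart_map @` chart_dom);
  chart_mapK : forall p, chart_dom p -> chart_inv (chart_map p) = p;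
  chart_map_cts : {within chart_dom, continuous chart_map};
  chart_inv_cts : {within chart_map @` chart_dom, continuous chart_inv}
}.

(* The orientation is carried by the atlas: transition maps preserve the
   standard orientation of R^2.  The atlas need not be maximal. *)
Definition oriented_atlas (R : realType) (N : topologicalType)
    (A : set (chart R N)) : Prop :=
  (forall p : N, exists2 c, A c & chart_dom c p) /\
  (forall c d, A c -> A d ->
     let U := chart_map c @` (chart_dom c `&` chart_dom d) in
     let t := chart_map d \o chart_inv c in
     smooth_on U t /\ forall x, U x -> 0 < \det ('J t x)).

Record oriented_surface (R : realType) := OrientedSurface {
  carrier :> topologicalType;
  atlas : set (chart R carrier);
  surface_hausdorff : hausdorff_space carrier;
  surface_second_countable : @second_countable carrier;
  surface_connected : connected [set: carrier];
  atlas_oriented : oriented_atlas atlas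
}.

Section Immersions.
Variables (R : realType) (N : oriented_surface R) (f : N -> 'rV[R]_4).

Definition local_rep (c : chart R N) : 'rV[R]_2 -> 'rV[R]_4 :=
  f \o chart_inv c.

Definition immersion : Prop :=
  forall c, atlas c ->
    let U := chart_map c @` chart_dom c in
    smooth_on U (local_rep c) /\
    forall x, U x -> injective ('d (local_rep c) x).

(* The rows e_1, e_2 of E form a positive orthonormal basis of the oriented
   plane T_pN: the rows of the Jacobian are the coordinate vectors of a
   positively oriented chart at p, and P is the change of basis. *)
Definition positive_tangent_onb (p : N) (E : 'M[R]_(2, 4)) : Prop :=
  orthonormal_rows E /\
  exists c, [/\ atlas c, chart_dom c p &
    exists2 P : 'M[R]_2, 0 < \det P & E = P *m 'J (local_rep c) (chart_map c p)].

End Immersions.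

Section MeanCurvature.
Variables (R : realType) (g : 'rV[R]_2 -> 'rV[R]_4) (x : 'rV[R]_2).

Definition first_form : 'M[R]_2 := 'J g x *m ('J g x)^T.

(* w minus its orthogonal projection on the span of the rows of 'J g x *)
Definition normal_part (w : 'rV[R]_4) : 'rV[R]_4 :=
  w - w *m ('J g x)^T *m invmx first_form *m 'J g x.

Definition second_form (i j : 'I_2) : 'rV[R]_4 :=
  normal_part ('D_(delta_mx 0 i) ('D_(delta_mx 0 j) g) x).

Definition mean_curvature : 'rV[R]_4 :=
  2^-1 *: \sum_i \sum_j invmx first_form i j *: second_form i j.

End MeanCurvature.

Definition minimal (R : realType) (N : oriented_surface R)
    (f : N -> 'rV[R]_4) : Prop :=
  forall c, atlas c -> forall x, (chart_map c @` chart_dom c) x ->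
    mean_curvature (local_rep f c) x = 0.

Section ComplexStructures.
Variable R : realType.
Implicit Types J : 'M[R]_4.

Definition compatible_cs J : Prop :=
  J *m J = - 1%:M /\ forall X Y : 'rV[R]_4, dotp (X *m J) (Y *m J) = dotp X Y.

Definition J_basis J (E : 'M[R]_4) : Prop :=
  [/\ orthonormal_rows E, row 0 E *m J = row 1 E & row 2 E *m J = row 3 E].

Definition Jplus J : Prop :=
  compatible_cs J /\ forall E, J_basis J E -> 0 < \det E.

Definition Jminus J : Prop :=
  compatible_cs J /\ forall E, J_basis J E -> \det E < 0.

(* alpha_J(V), computed from a positive orthonormal basis E of V; see
   [plane_angle_basis] for the independence of E. *)
Definition plane_angle J (E : 'M[R]_(2, 4)) : R :=
  acos (dotp (row 0 E *m J) (row 1 E)).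

Definition alpha_slant (N : oriented_surface R) (f : N -> 'rV[R]_4) J
    (alpha : R) : Prop :=
  forall p E, positive_tangent_onb f p E -> plane_angle J E = alpha.

Definition slant (N : oriented_surface R) (f : N -> 'rV[R]_4) J : Prop :=
  exists2 alpha : R, 0 <= alpha <= pi & alpha_slant f J alpha.

Lemma plane_angle_basis J (E : 'M[R]_(2, 4)) (P : 'M[R]_2) :
  compatible_cs J -> orthonormal_rows E -> orthonormal_rows (P *m E) ->
  0 < \det P -> plane_angle J (P *m E) = plane_angle J E.
Proof.
move=> [J2 Jiso] oE oPE dP.
have gramE (F : 'M[R]_(2, 4)) : orthonormal_rows F -> F *m F^T = 1%:M.
  move=> oF; apply/matrixP => i j; rewrite mxE [RHS]mxE -oF /dotp mxE.
  by apply: eq_bigr => k _; rewrite !mxE.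
have PP : P *m P^T = 1%:M.
  by have := gramE _ oPE; rewrite trmx_mul mulmxA -(mulmxA P) gramE // mulmx1.
have dP1 : \det P = 1.
  have : \det P ^+ 2 = 1 by rewrite expr2 -{2}det_tr -det_mulmx PP det1.
  by move/eqP; rewrite sqrf_eq1 => /orP[/eqP//|/eqP dN]; move: dP; rewrite dN ltr0N1.
have dotpC (X Y : 'rV[R]_4) : dotp X Y = dotp Y X.
  by rewrite /dotp !mxE; apply: eq_bigr => k _; rewrite !mxE mulrC.
have skew X Y : dotp (X *m J) Y = - dotp (Y *m J) X.
  rewrite -Jiso -mulmxA J2 mulmxN mulmx1 /dotp mulNmx mxE.
  by congr (- _); exact: dotpC.
have entE (F : 'M[R]_(2, 4)) i j :
    dotp (row i F *m J) (row j F) = (F *m J *m F^T) i j.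
  by rewrite /dotp -row_mul !mxE; apply: eq_bigr => k _; rewrite !mxE.
rewrite /plane_angle !entE; congr (acos _).
have -> : P *m E *m J *m (P *m E)^T = P *m (E *m J *m E^T) *m P^T.
  by rewrite trmx_mul !mulmxA.
set S := E *m J *m E^T.
have Sskew i j : S i j = - S j i by rewrite -!entE skew.
have S0 i : S i i = 0.
  by apply/eqP; have /eqP := Sskew i i; rewrite -addr_eq0 -mulr2n mulrn_eq0.
have dPE : \det P = P 0 0 * P 1 1 - P 0 1 * P 1 0.
  rewrite (expand_det_row _ 0) !big_ord_recl big_ord0 /cofactor !det_mx11 !mxE /=.
  have -> : lift ord0 ord0 = 1 :> 'I_2 by apply: val_inj.
  have -> : lift 1 0 = 0 :> 'I_2 by apply: val_inj.
  rewrite /= /bump /= addn0 expr0 expr1.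
  by ring.
rewrite dP1 in dPE; clearbody S.
rewrite !mxE !big_ord_recl !big_ord0 !mxE !big_ord_recl !big_ord0 /=.
have -> : lift ord0 ord0 = 1 :> 'I_2 by apply: val_inj.
rewrite !S0 (Sskew 1 0) !(mulr0, addr0, add0r).
by rewrite -[RHS]mul1r dPE; ring.
Qed.

End ComplexStructures.

(* Main.v *)
Require Import Defs.
From HB Require Import structures.
From mathcomp Require Import all_boot all_order all_algebra.
From mathcomp Require Import all_classical all_reals all_analysis.
From mathcomp Require Import ring lra.
Set Implicit Arguments.
Unset Strict Implicit.
Unset Printing Implicit Defensive.
Import Order.TTheory GRing.Theory Num.Theory.
Import numFieldNormedType.Exports.
Local Open Scope classical_set_scope.
Local Open Scope ring_scope.

(** The matrices in [Jplus] and [Jminus] form two unit 2-spheres: they are the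
    [cs_mx s u] with [s = 1] and [s = -1] and [u] a unit vector of R^3.  For
    coordinate tangent vectors [g0, g1], let [w = wedge s g0 g1] be the vector
    of R^3 such that [dotp u w = dotp (g0 *m cs_mx s u) g1]; then [w / |w|] is a
    component of the Gauss map, and the slant angle with respect to [cs_mx s u]
    is the angle between [u] and [w].  So [f] is slant iff [w / |w|] stays in a
    circle around [u].

    Differentiating [(u.w)^2 = C |w|^2] shows that the derivatives [V0, V1] of
    the direction of [w] are orthogonal to [u].  A quaternionic identity
    expresses [wedge s g0 H], with [H] a multiple of the mean curvature vector
    up to tangent vectors, as a combination of [V0], [V1] and [w x V0] modulo
    [w].  If [H] is tangent, then [V0] is also orthogonal to [u x w], so that
    the direction of [w] is locally constant, hence constant by connectedness.
    Conversely, if [f] is slant with respect to two non-opposite structures,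
    the direction of [w] is locally constant, [wedge s g0 H] is parallel to
    [wedge s g0 g1], and [H] is tangent. *)

(** * Linear algebra *)

Section Dotp.
Variables (R : realType) (n : nat).
Implicit Types X Y Z : 'rV[R]_n.

Lemma dotpE X Y : dotp X Y = \sum_i X 0 i * Y 0 i.
Proof. by rewrite /dotp mxE; apply: eq_bigr => i _; rewrite mxE. Qed.

Lemma dotpC X Y : dotp X Y = dotp Y X.
Proof. by rewrite !dotpE; apply: eq_bigr => i _; rewrite mulrC. Qed.

Lemma dotpDl X Y Z : dotp (X + Y) Z = dotp X Z + dotp Y Z.
Proof. by rewrite /dotp mulmxDl mxE. Qed.

Lemma dotpZl a X Y : dotp (a *: X) Y = a * dotp X Y.
Proof. by rewrite /dotp -scalemxAl mxE. Qed.

Lemma dotpNl X Y : dotp (- X) Y = - dotp X Y.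
Proof. by rewrite -scaleN1r dotpZl mulN1r. Qed.

Lemma dotpBl X Y Z : dotp (X - Y) Z = dotp X Z - dotp Y Z.
Proof. by rewrite dotpDl dotpNl. Qed.

Lemma dotpDr X Y Z : dotp X (Y + Z) = dotp X Y + dotp X Z.
Proof. by rewrite dotpC dotpDl !(dotpC _ X). Qed.

Lemma dotpZr a X Y : dotp X (a *: Y) = a * dotp X Y.
Proof. by rewrite dotpC dotpZl dotpC. Qed.

Lemma dotpNr X Y : dotp X (- Y) = - dotp X Y.
Proof. by rewrite dotpC dotpNl dotpC. Qed.

Lemma dotpBr X Y Z : dotp X (Y - Z) = dotp X Y - dotp X Z.
Proof. by rewrite dotpDr dotpNr. Qed.

Lemma dotp0r X : dotp X 0 = 0.
Proof. by rewrite -(scale0r 0) dotpZr mul0r. Qed.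

Lemma dotp0l X : dotp 0 X = 0.
Proof. by rewrite dotpC dotp0r. Qed.

Lemma dotp_ge0 X : 0 <= dotp X X.
Proof. by rewrite dotpE sumr_ge0// => i _; rewrite -expr2 sqr_ge0. Qed.

Lemma dotp_eq0 X : (dotp X X == 0) = (X == 0).
Proof.
apply/idP/eqP => [|->]; last by rewrite dotp0r.
rewrite dotpE psumr_eq0 => [/allP X0|i _]; last by rewrite -expr2 sqr_ge0.
apply/rowP => i; rewrite mxE; have := X0 i (mem_index_enum i).
by rewrite /= -expr2 sqrf_eq0 => /eqP.
Qed.

Lemma dotp_gt0 X : (0 < dotp X X) = (X != 0).
Proof. by rewrite lt_neqAle dotp_ge0 andbT eq_sym dotp_eq0. Qed.

Lemma dotp_delta X i : dotp (delta_mx 0 i) X = X 0 i.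
Proof. by rewrite /dotp -rowE !mxE. Qed.

End Dotp.

Section Matrix2.
Variable R : realType.

Lemma ord2P (i : 'I_2) : i = 0 \/ i = 1.
Proof. by case: i => [[|[|//]] lk]; [left|right]; exact/val_inj. Qed.

Lemma sum_ord2 (V : nmodType) (F : 'I_2 -> V) : \sum_i F i = F 0 + F 1.
Proof.
rewrite !big_ord_recl big_ord0 addr0; congr (_ + F _); exact/val_inj.
Qed.

Lemma det2E (P : 'M[R]_2) : \det P = P 0 0 * P 1 1 - P 0 1 * P 1 0.
Proof.
rewrite (expand_det_row _ 0) sum_ord2 /cofactor !det_mx11 !mxE.
have -> : lift 0 0 = 1 :> 'I_2 by exact/val_inj.
have -> : lift 1 0 = 0 :> 'I_2 by exact/val_inj.
by rewrite /= addn0 expr0 expr1; ring.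
Qed.

Lemma invmx2E (M : 'M[R]_2) : \det M != 0 ->
  [/\ invmx M 0 0 = M 1 1 / \det M, invmx M 0 1 = - M 0 1 / \det M,
      invmx M 1 0 = - M 1 0 / \det M & invmx M 1 1 = M 0 0 / \det M].
Proof.
move=> M0; pose M' : 'M[R]_2 := \matrix_(i, j)
  (nth 0 (nth [::] [:: [:: M 1 1; - M 0 1]; [:: - M 1 0; M 0 0]] i) j / \det M).
have MM' : M *m M' = 1%:M.
  apply/matrixP => i j; rewrite mxE sum_ord2 /M' !mxE.
  move: M0; rewrite det2E => M0.
  by case: (ord2P i) => ->; case: (ord2P j) => -> /=; field.
have -> : invmx M = M'.
  by rewrite -[LHS]mulmx1 -MM' mulKmx// unitmxE unitfE.
by rewrite !mxE.
Qed.

End Matrix2.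

Lemma ord3E : [/\ lift ord0 ord0 = 1 :> 'I_3 & lift ord0 (lift ord0 ord0) = 2 :> 'I_3].
Proof. by split; apply/val_inj. Qed.

Lemma ord4E : [/\ lift ord0 ord0 = 1 :> 'I_4, lift ord0 (lift ord0 ord0) = 2 :> 'I_4
  & lift ord0 (lift ord0 (lift ord0 ord0)) = 3 :> 'I_4].
Proof. by split; apply/val_inj. Qed.

Lemma ord4P (i : 'I_4) : [\/ i = 0, i = 1, i = 2 | i = 3].
Proof.
case: i => [[|[|[|[|//]]]] lti];
  [constructor 1|constructor 2|constructor 3|constructor 4]; exact/val_inj.
Qed.

Section Coordinates.
Variable R : realType.

Lemma dotp3E (u v : 'rV[R]_3) :
  dotp u v = u 0 0 * v 0 0 + u 0 1 * v 0 1 + u 0 2 * v 0 2.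
Proof.
have [e1 e2] := ord3E.
by rewrite dotpE !big_ord_recl big_ord0 addr0 e1 e2 !addrA.
Qed.

Lemma dotp4E (X Y : 'rV[R]_4) :
  dotp X Y = X 0 0 * Y 0 0 + X 0 1 * Y 0 1 + X 0 2 * Y 0 2 + X 0 3 * Y 0 3.
Proof.
have [e1 e2 e3] := ord4E.
by rewrite dotpE !big_ord_recl big_ord0 addr0 e1 e2 e3 !addrA.
Qed.

Definition row3 (a b c : R) : 'rV[R]_3 := \row_i [:: a; b; c]`_i.

Lemma row3E a b c :
  ((row3 a b c 0 0 = a) * (row3 a b c 0 1 = b) * (row3 a b c 0 2 = c))%type.
Proof. by rewrite !mxE. Qed.

Lemma row3P (u v : 'rV[R]_3) :
  u 0 0 = v 0 0 -> u 0 1 = v 0 1 -> u 0 2 = v 0 2 -> u = v.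
Proof.
move=> h0 h1 h2; apply/rowP => -[[|[|[|//]]] lti].
- by rewrite (_ : Ordinal lti = 0)//; apply/val_inj.
- by rewrite (_ : Ordinal lti = 1)//; apply/val_inj.
- by rewrite (_ : Ordinal lti = 2)//; apply/val_inj.
Qed.

Lemma row4P (u v : 'rV[R]_4) :
  u 0 0 = v 0 0 -> u 0 1 = v 0 1 -> u 0 2 = v 0 2 -> u 0 3 = v 0 3 -> u = v.
Proof.
move=> h0 h1 h2 h3; apply/rowP => -[[|[|[|[|//]]]] lti].
- by rewrite (_ : Ordinal lti = 0)//; apply/val_inj.
- by rewrite (_ : Ordinal lti = 1)//; apply/val_inj.
- by rewrite (_ : Ordinal lti = 2)//; apply/val_inj.
- by rewrite (_ : Ordinal lti = 3)//; apply/val_inj.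
Qed.

Definition cross (u v : 'rV[R]_3) : 'rV[R]_3 :=
  row3 (u 0 1 * v 0 2 - u 0 2 * v 0 1) (u 0 2 * v 0 0 - u 0 0 * v 0 2)
       (u 0 0 * v 0 1 - u 0 1 * v 0 0).

Lemma dotp_cross u v w : dotp u (cross v w) = dotp (cross u v) w.
Proof. by rewrite !dotp3E !row3E; ring. Qed.

Lemma cross_norm u v :
  dotp (cross u v) (cross u v) = dotp u u * dotp v v - dotp u v ^+ 2.
Proof. by rewrite !dotp3E !row3E; ring. Qed.

Lemma cross_double u v w :
  cross w (cross u v) = dotp w v *: u - dotp w u *: v.
Proof. by apply: row3P; rewrite !row3E !mxE !dotp3E; ring. Qed.

(* The Gram determinant of [u, v, w]. *)
Lemma triple_product_sqr u v w :
  dotp (cross u v) w ^+ 2 =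
  dotp w w * (dotp u u * dotp v v - dotp u v ^+ 2)
  - dotp v v * dotp u w ^+ 2 - dotp u u * dotp v w ^+ 2
  + 2 * (dotp u v * dotp u w * dotp v w).
Proof. by rewrite !dotp3E !row3E; ring. Qed.

(** The double product formula makes [cross w (cross u v)] vanish, and Lagrange's identity then
    reads |w|^2 |u x v|^2 = 0. *)
Lemma orthogonal_frame_eq0 u v w :
  cross u v != 0 -> dotp u w = 0 -> dotp v w = 0 -> dotp (cross u v) w = 0 ->
  w = 0.
Proof.
move=> uv0 uw vw uvw; have := cross_norm w (cross u v).
rewrite cross_double !(dotpC w) uw vw uvw !scale0r subrr dotp0l expr0n subr0.
move/esym/eqP; rewrite mulf_eq0 [X in _ || X]dotp_eq0 (negbTE uv0) orbF.
by rewrite dotp_eq0 => /eqP.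
Qed.

Lemma cross_eq0 u v : cross u v = 0 -> dotp u u *: v = dotp u v *: u.
Proof.
move=> uv0; apply/eqP; rewrite eq_sym -subr_eq0 -cross_double uv0.
by apply/eqP/row3P; rewrite !row3E !mxE !mulr0 subrr.
Qed.

(* For [s = 1] (resp. [-1]) and [u] a unit vector, the matrices [cs_mx s u] are
   the positive (resp. negative) compatible complex structures, and
   [wedge s X Y] is the self-dual (resp. anti-self-dual) part of the bivector
   [X ^ Y], up to a factor. *)
Definition cs_mx (s : R) (u : 'rV[R]_3) : 'M[R]_4 :=
  let a := u 0 0 in let b := u 0 1 in let c := u 0 2 in
  \matrix_(i, j) nth 0 (nth [::] [::
    [::   0;      a;       b;       c];
    [:: - a;      0;   s * c; - s * b];
    [:: - b; - s * c;      0;   s * a];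
    [:: - c;  s * b; - s * a;       0]] i) j.

Definition wedge (s : R) (X Y : 'rV[R]_4) : 'rV[R]_3 :=
  row3 (X 0 0 * Y 0 1 - X 0 1 * Y 0 0 + s * (X 0 2 * Y 0 3 - X 0 3 * Y 0 2))
       (X 0 0 * Y 0 2 - X 0 2 * Y 0 0 + s * (X 0 3 * Y 0 1 - X 0 1 * Y 0 3))
       (X 0 0 * Y 0 3 - X 0 3 * Y 0 0 + s * (X 0 1 * Y 0 2 - X 0 2 * Y 0 1)).

Lemma mul_cs_mxE s u (X : 'rV[R]_4) :
  [/\ (X *m cs_mx s u) 0 0 = - X 0 1 * u 0 0 - X 0 2 * u 0 1 - X 0 3 * u 0 2,
     (X *m cs_mx s u) 0 1 = X 0 0 * u 0 0 + s * (X 0 3 * u 0 1 - X 0 2 * u 0 2),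
     (X *m cs_mx s u) 0 2 = X 0 0 * u 0 1 + s * (X 0 1 * u 0 2 - X 0 3 * u 0 0)
   & (X *m cs_mx s u) 0 3 = X 0 0 * u 0 2 + s * (X 0 2 * u 0 0 - X 0 1 * u 0 1)].
Proof.
have [e1 e2 e3] := ord4E.
by split; rewrite mxE !big_ord_recl big_ord0 e1 e2 e3 !mxE /=; ring.
Qed.

(** This pairing turns slant angles in E^4 into angles between vectors of R^3. *)
Lemma dotp_wedge s u X Y : dotp u (wedge s X Y) = dotp (X *m cs_mx s u) Y.
Proof.
have [h0 h1 h2 h3] := mul_cs_mxE s u X.
by rewrite dotp3E dotp4E !row3E h0 h1 h2 h3; ring.
Qed.

Lemma wedgexx s X : wedge s X X = 0.
Proof. by apply: row3P; rewrite !mxE /=; ring. Qed.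

Lemma wedgeC s X Y : wedge s X Y = - wedge s Y X.
Proof. by apply: row3P; rewrite !mxE /=; ring. Qed.

Section Sign.
Variables (s : R) (s2 : s ^+ 2 = 1).

Let s_cases : s = 1 \/ s = -1.
Proof. by move/eqP: s2; rewrite sqrf_eq1 => /orP[] /eqP; [left|right]. Qed.

(** The cross terms of the square carry the factor s and cancel by the Plücker relation; what
    remains is the Gram determinant of X and Y, whatever the sign s. *)
Lemma wedge_norm X Y :
  dotp (wedge s X Y) (wedge s X Y) = dotp X X * dotp Y Y - dotp X Y ^+ 2.
Proof. by rewrite dotp3E !dotp4E !row3E; case: s_cases => ->; ring. Qed.

(* For [s = -1] this is the imaginary part of the quaternion identity
   [(X' Y) (Y' Z) = |Y|^2 (X' Z)], where [X'] is the conjugate of [X]; for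
   [s = 1], replace [X' Y] by [Y X']. *)
Lemma cross_wedge X Y Z :
  s *: cross (wedge s X Y) (wedge s Z Y) =
  dotp Y Y *: wedge s X Z + dotp X Y *: wedge s Z Y - dotp Z Y *: wedge s X Y.
Proof.
by apply: row3P; rewrite !mxE /= ?mxE /= ?dotp4E; case: s_cases => ->; ring.
Qed.

End Sign.
End Coordinates.

(** * Change of frame, and the identity linking the wedge to mean curvature *)

Section Wedge.
Variables (R : realType) (s : R).
Implicit Types X Y Z : 'rV[R]_4.

Lemma wedgeDl X Y Z : wedge s (X + Y) Z = wedge s X Z + wedge s Y Z.
Proof. by apply: row3P; rewrite !mxE /= ?mxE; ring. Qed.

Lemma wedgeZl a X Y : wedge s (a *: X) Y = a *: wedge s X Y.
Proof. by apply: row3P; rewrite !mxE /= ?mxE; ring. Qed.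

Lemma wedgeDr X Y Z : wedge s X (Y + Z) = wedge s X Y + wedge s X Z.
Proof. by apply: row3P; rewrite !mxE /= ?mxE; ring. Qed.

Lemma wedgeZr a X Y : wedge s X (a *: Y) = a *: wedge s X Y.
Proof. by apply: row3P; rewrite !mxE /= ?mxE; ring. Qed.

Lemma wedgeNr X Y : wedge s X (- Y) = - wedge s X Y.
Proof. by rewrite -scaleN1r wedgeZr scaleN1r. Qed.

Definition row_wedge (M : 'M[R]_(2, 4)) := wedge s (row 0 M) (row 1 M).

Lemma row_mul2 (P : 'M[R]_2) (M : 'M[R]_(2, 4)) i :
  row i (P *m M) = P i 0 *: row 0 M + P i 1 *: row 1 M.
Proof. by rewrite row_mul mulmx_sum_row sum_ord2 !mxE. Qed.

(** Hence the direction of [row_wedge] depends only on the oriented plane spanned by the rows. *)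
Lemma row_wedge_mul (P : 'M[R]_2) M :
  row_wedge (P *m M) = \det P *: row_wedge M.
Proof.
rewrite /row_wedge !row_mul2 det2E !(wedgeDl, wedgeDr, wedgeZl, wedgeZr).
rewrite !wedgexx (wedgeC s (row 1 M)); apply: row3P; rewrite !mxE; ring.
Qed.

Section Identity.
Hypothesis s2 : s ^+ 2 = 1.

Lemma orthonormal_row_wedge (E : 'M[R]_(2, 4)) :
  orthonormal_rows E -> dotp (row_wedge E) (row_wedge E) = 1.
Proof. by move=> oE; rewrite wedge_norm// !oE/= expr0n subr0 mulr1. Qed.

Lemma gram_schmidt (M : 'M[R]_(2, 4)) : row_wedge M != 0 ->
  exists2 P : 'M[R]_2, 0 < \det P & orthonormal_rows (P *m M).
Proof.
rewrite -dotp_gt0 wedge_norm//; set p := row 0 M; set q := row 1 M => D_gt0.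
set D := _ - _ in D_gt0.
have p_gt0 : 0 < dotp p p.
  rewrite dotp_gt0; apply: contraTneq D_gt0 => p0.
  by rewrite /D p0 !dotp0l mul0r sub0r expr0n oppr0 ltxx.
set a := Num.sqrt (dotp p p); set d := Num.sqrt D.
have a_gt0 : 0 < a by rewrite sqrtr_gt0.
have d_gt0 : 0 < d by rewrite sqrtr_gt0.
have a2 : dotp p p = a ^+ 2 by rewrite sqr_sqrtr// ltW.
have d2 : a ^+ 2 * dotp q q = d ^+ 2 + dotp p q ^+ 2.
  have -> : d ^+ 2 = D by rewrite sqr_sqrtr// ltW.
  by rewrite /D a2; ring.
have {}d2 : dotp q q = (d ^+ 2 + dotp p q ^+ 2) / a ^+ 2.
  by rewrite -d2 mulrC mulKf// expf_neq0// gt_eqF.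
(* Here a is the length of p and d the area of the parallelogram on p and q, so d / a is the height
   of q over p. The matrix is triangular with positive diagonal, which gives its positive
   determinant. *)
pose P : 'M[R]_2 := \matrix_(i, j)
  nth 0 (nth [::] [:: [:: a^-1; 0]; [:: - dotp p q / (a * d); a / d]] i) j.
exists P.
  by rewrite det2E !mxE/= mul0r subr0 mulr_gt0 ?invr_gt0// divr_gt0.
have a0 : a != 0 by rewrite gt_eqF.
have d0 : d != 0 by rewrite gt_eqF.
have e0 : row 0 (P *m M) = a^-1 *: p.
  by rewrite row_mul2 !mxE/= scale0r addr0.
have e1 : row 1 (P *m M) = (- dotp p q / (a * d)) *: p + (a / d) *: q.
  by rewrite row_mul2 !mxE/=.
have h00 : dotp (row 0 (P *m M)) (row 0 (P *m M)) = 1.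
  by rewrite e0 dotpZl dotpZr a2; field.
have h01 : dotp (row 0 (P *m M)) (row 1 (P *m M)) = 0.
  by rewrite e0 e1 dotpZl dotpDr !dotpZr a2; field; rewrite a0 d0.
have h11 : dotp (row 1 (P *m M)) (row 1 (P *m M)) = 1.
  rewrite e1 !(dotpDl, dotpDr, dotpZl, dotpZr) a2 d2 (dotpC q p).
  by field; rewrite a0 d0.
move=> i j.
by case: (ord2P i) => ->; case: (ord2P j) => -> //; rewrite dotpC.
Qed.

(* Up to a factor, the component of [v] normal to [w]. *)
Definition perp (w v : 'rV[R]_3) := dotp w w *: v - dotp w v *: w.

Lemma dotp_perp w v : dotp w (perp w v) = 0.
Proof. by rewrite dotpBr !dotpZr mulrC subrr. Qed.

Lemma perp_cross w v : perp w (cross w v) = cross w (perp w v).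
Proof. by apply: row3P; rewrite !mxE /= ?mxE /= !dotp3E ?row3E; ring. Qed.

Variables (p q A B C : 'rV[R]_4).
Let w := wedge s p q.
Let w0 := wedge s A q + wedge s p B.
Let w1 := wedge s B q + wedge s p C.

(* With [p, q] the partial derivatives of an immersion and [A, B, C] its second
   ones, [w0] and [w1] are the partial derivatives of [w], and the component of
   [curvature_comb] normal to [p, q] is the mean curvature vector, up to a
   factor. *)
Definition curvature_comb :=
  dotp q q *: A - (2 * dotp p q) *: B + dotp p p *: C.
Local Notation H := curvature_comb.

(** Apply [cross_wedge] to the two halves A ^ q and p ^ B of w0. Subtracting (p.q) w0 and adding
    |p|^2 w1 cancels the terms in A ^ q and B ^ q, and only p ^ H and multiples of w remain. *)
Lemma wedge_curvature_comb : wedge s p H =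
  s *: cross w w0 - dotp p q *: w0 + dotp p p *: w1
  + (dotp A q - dotp B p) *: w.
Proof.
have crossDr x y z : cross x (y + z) = cross x y + cross x z :> 'rV[R]_3.
  by apply: row3P; rewrite !mxE /=; ring.
have hA := cross_wedge s2 p q A.
have hB := cross_wedge s2 q p B.
have hAB : cross (wedge s q p) (wedge s B p) = cross w (wedge s p B).
  by rewrite wedgeC (wedgeC s B p); apply: row3P; rewrite !mxE /= ?mxE; ring.
rewrite hAB in hB.
rewrite /w0 crossDr scalerDr hA hB /w1 /H !(wedgeDr, wedgeZr, wedgeNr).
rewrite (wedgeC s q B) (wedgeC s q p) (wedgeC s B p) (dotpC q p) -/w.
by apply: row3P; rewrite !mxE; ring.
Qed.

Lemma perp_curvature_comb : perp w (wedge s p H) =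
  s *: cross w (perp w w0) - dotp p q *: perp w w0 + dotp p p *: perp w w1.
Proof.
rewrite wedge_curvature_comb -perp_cross; move: (cross w w0) w0 w1 w => z x y v.
by apply: row3P; rewrite /perp !mxE !(dotpDr, dotpZr, dotpNr); ring.
Qed.

(* The Gauss map of a minimal surface is conformal. *)
Lemma tangent_curvature_comb u : (exists a b, H = a *: p + b *: q) ->
  p != 0 -> cross u w != 0 ->
  dotp u (perp w w0) = 0 -> dotp u (perp w w1) = 0 ->
  perp w w0 = 0 /\ perp w w1 = 0.
Proof.
move=> [a [b Hpq]] p0 uw u0 u1.
have := perp_curvature_comb.
rewrite {1}Hpq wedgeDr !wedgeZr wedgexx scaler0 add0r -/w.
rewrite {1}/perp dotpZr scalerA mulrC subrr => /esym.
move: (dotp_perp w w0) u0 u1; move: (perp w w0) (perp w w1) => V0 V1.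
move=> wV0 uV0 uV1 h.
(* Pairing [h] with u removes the terms in V0 and V1 and leaves s (u x w).V0 = 0. So V0 is
   orthogonal to u, w and u x w. *)
have {}V0_eq0 : V0 = 0.
  apply: (orthogonal_frame_eq0 uw) => //.
  rewrite -dotp_cross; have := congr1 (dotp u) h.
  rewrite dotp0r !(dotpDr, dotpZr, dotpNr) uV0 uV1 !mulr0 oppr0 !addr0.
  move/eqP; rewrite mulf_eq0 => /orP[/eqP s0|/eqP//].
  by move/eqP: s2; rewrite s0 expr0n/= eq_sym oner_eq0.
split=> //; move: h; rewrite V0_eq0 scaler0 subr0.
have -> : cross w 0 = 0 by apply: row3P; rewrite !mxE/= ?mxE !mulr0 subrr.
rewrite scaler0 add0r => /eqP.
by rewrite scaler_eq0 dotp_eq0 (negbTE p0) => /eqP.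
Qed.

(** The hypotheses make p ^ H parallel to w = p ^ q, so p ^ Z = 0 for a combination Z of H and q. By
    [wedge_norm] this is the equality case of Cauchy-Schwarz, and Z is a multiple of p. *)
Lemma perp0_tangent_curvature_comb : w != 0 ->
  perp w w0 = 0 -> perp w w1 = 0 -> exists a b, H = a *: p + b *: q.
Proof.
move=> w_neq0 V0 V1; have := perp_curvature_comb; rewrite V0 V1 !scaler0.
have -> : cross w 0 = 0 by apply: row3P; rewrite !mxE/= ?mxE !mulr0 subrr.
rewrite scaler0 subr0 addr0 /perp => /subr0_eq h.
have p0 : p != 0.
  by apply: contra_neq w_neq0 => p0; apply: row3P; rewrite !mxE/= p0 !mxE; ring.
set c := dotp w (wedge _ _ _) in h; set D := dotp w w in h.
have D0 : D != 0 by rewrite dotp_eq0.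
pose Z := D *: H - c *: q.
have Z0 : wedge s p Z = 0.
  by rewrite /Z wedgeDr wedgeNr !wedgeZr h subrr.
have ZE : Z = D *: H - c *: q by [].
move: Z Z0 ZE => Z Z0 ZE.
have Zp : dotp p p *: Z = dotp p Z *: p.
  apply/eqP; rewrite -subr_eq0 -dotp_eq0.
  rewrite !(dotpDl, dotpDr, dotpNl, dotpNr, dotpZl, dotpZr) (dotpC Z p).
  have := wedge_norm s2 p Z; rewrite Z0 dotp0r => e.
  by apply/eqP; rewrite -[RHS](mulr0 (dotp p p)) e; ring.
have pp0 : dotp p p != 0 by rewrite dotp_eq0.
exists (dotp p Z / (dotp p p * D)), (c / D).
apply: (scalerI D0); apply: (scalerI pp0).
rewrite -[D *: H](subrK (c *: q)) -ZE scalerDr Zp.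
by rewrite !scalerDr !scalerA; congr (_ *: _ + _ *: _); field; rewrite ?pp0 ?D0.
Qed.

End Identity.
End Wedge.

(** * Compatible complex structures *)

Section Det4.
Variable R : realType.

Let det3nat (a : nat -> nat -> R) : \det (\matrix_(i < 3, j < 3) a i j) =
  a 0 0 * (a 1 1 * a 2 2 - a 1 2 * a 2 1)
  - a 0 1 * (a 1 0 * a 2 2 - a 1 2 * a 2 0)
  + a 0 2 * (a 1 0 * a 2 1 - a 1 1 * a 2 0).
Proof.
rewrite (expand_det_row _ 0) !big_ord_recl big_ord0 /cofactor !det2E !mxE /=.
rewrite /bump /=; ring.
Qed.

(** Entries indexed by natural numbers let the indices of the minors reduce by computing [bump]. *)
Let det4nat (a : nat -> nat -> R) : \det (\matrix_(i < 4, j < 4) a i j) =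
  let d i j k := a 1 i * (a 2 j * a 3 k - a 2 k * a 3 j)
  - a 1 j * (a 2 i * a 3 k - a 2 k * a 3 i)
  + a 1 k * (a 2 i * a 3 j - a 2 j * a 3 i) in
  a 0 0 * d 1 2 3 - a 0 1 * d 0 2 3 + a 0 2 * d 0 1 3 - a 0 3 * d 0 1 2.
Proof.
rewrite (expand_det_row _ 0) !big_ord_recl big_ord0 /cofactor.
rewrite !mxE /=.
have minor (j : nat) : \det (\matrix_(k < 3, l < 3) a k.+1 (bump j l)) =
    a 1 (bump j 0) * (a 2 (bump j 1) * a 3 (bump j 2) - a 2 (bump j 2) * a 3 (bump j 1))
  - a 1 (bump j 1) * (a 2 (bump j 0) * a 3 (bump j 2) - a 2 (bump j 2) * a 3 (bump j 0))
  + a 1 (bump j 2) * (a 2 (bump j 0) * a 3 (bump j 1) - a 2 (bump j 1) * a 3 (bump j 0)).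
  by rewrite (det3nat (fun k l => a k.+1 (bump j l))).
have rowcol (j : 'I_4) : row' 0 (col' j (\matrix_(i < 4, j < 4) a i j)) =
    \matrix_(k < 3, l < 3) a k.+1 (bump j l).
  by apply/matrixP => k l; rewrite !mxE.
rewrite !rowcol !minor /bump /=; ring.
Qed.

Lemma det4E (E : 'M[R]_4) : \det E =
  let d i j k := E 1 i * (E 2 j * E 3 k - E 2 k * E 3 j)
  - E 1 j * (E 2 i * E 3 k - E 2 k * E 3 i)
  + E 1 k * (E 2 i * E 3 j - E 2 j * E 3 i) in
  E 0 0 * d 1 2 3 - E 0 1 * d 0 2 3 + E 0 2 * d 0 1 3 - E 0 3 * d 0 1 2.
Proof.
pose a i j := E (inord i) (inord j).
have -> : \det E = \det (\matrix_(i < 4, j < 4) a i j).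
  by congr (\det _); apply/matrixP => i j; rewrite mxE /a !inord_val.
rewrite det4nat /a.
have -> : inord 0 = 0 :> 'I_4 by apply/val_inj; rewrite /= inordK.
have -> : inord 1 = 1 :> 'I_4 by apply/val_inj; rewrite /= inordK.
have -> : inord 2 = 2 :> 'I_4 by apply/val_inj; rewrite /= inordK.
by have -> : inord 3 = 3 :> 'I_4 by apply/val_inj; rewrite /= inordK.
Qed.

End Det4.

(** * The complex structures [cs_mx s u] and their orientation *)

Section ComplexStructures.
Variable R : realType.
Implicit Types (s t : R) (u v : 'rV[R]_3) (X Y : 'rV[R]_4) (J : 'M[R]_4).

Definition signed_cs s J : Prop :=
  compatible_cs J /\ forall E, J_basis J E -> 0 < s * \det E.

Lemma JplusE J : Jplus J <-> signed_cs 1 J.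
Proof. by split=> -[cJ dJ]; split=> // E /dJ; rewrite mul1r. Qed.

Lemma JminusE J : Jminus J <-> signed_cs (-1) J.
Proof. by split=> -[cJ dJ]; split=> // E /dJ; rewrite mulN1r oppr_gt0. Qed.

Lemma exists_orthogonal_unit u : exists2 v, dotp v v = 1 & dotp u v = 0.
Proof.
(* This vector is orthogonal to u. If it is zero, u lies on the third axis and the first basis
   vector serves. *)
have [u0|u_neq0] := eqVneq (row3 (u 0 1) (- u 0 0) 0) 0.
  exists (row3 1 0 0); rewrite !dotp3E !row3E; first by ring.
  have := congr1 (fun x : 'rV[R]_3 => x 0 1) u0 => /=.
  by rewrite row3E mxE => /eqP; rewrite oppr_eq0 => /eqP->; ring.
set x := row3 _ _ _ in u_neq0.
have x_gt0 : 0 < dotp x x by rewrite dotp_gt0.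
exists ((Num.sqrt (dotp x x))^-1 *: x).
  rewrite dotpZl dotpZr mulrA -expr2 exprVn sqr_sqrtr ?ltW//.
  by rewrite mulVf// gt_eqF.
by rewrite dotpZr (_ : dotp u x = 0) ?mulr0// /x dotp3E !row3E; ring.
Qed.

Section Sign.
Variables (s : R) (s2 : s ^+ 2 = 1).

Let s_cases : s = 1 \/ s = -1.
Proof. by move/eqP: s2; rewrite sqrf_eq1 => /orP[] /eqP; [left|right]. Qed.

Lemma cs_mxN u : cs_mx s (- u) = - cs_mx s u.
Proof.
apply/matrixP => i j; rewrite [RHS]mxE.
case: (ord4P i) => ->; case: (ord4P j) => ->; rewrite !mxE /=; ring.
Qed.

(** On quaternions, [X *m cs_mx s u] is the product u X for s = 1 and X u for s = -1, with u
    imaginary; and the square of u is -|u|^2. *)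
Lemma mul_cs_mx2 u X : X *m cs_mx s u *m cs_mx s u = - dotp u u *: X.
Proof.
have [a0 a1 a2 a3] := mul_cs_mxE s u X.
have [b0 b1 b2 b3] := mul_cs_mxE s u (X *m cs_mx s u).
apply: row4P; rewrite ?b0 ?b1 ?b2 ?b3 ?a0 ?a1 ?a2 ?a3 [RHS]mxE dotp3E;
  by case: s_cases => ->; ring.
Qed.

Lemma dotp_mul_cs_mx u X Y :
  dotp (X *m cs_mx s u) (Y *m cs_mx s u) = dotp u u * dotp X Y.
Proof.
have [a0 a1 a2 a3] := mul_cs_mxE s u X.
have [b0 b1 b2 b3] := mul_cs_mxE s u Y.
rewrite !dotp4E dotp3E a0 a1 a2 a3 b0 b1 b2 b3.
by case: s_cases => ->; ring.
Qed.

Lemma dotp_cs_mxx u X : dotp (X *m cs_mx s u) X = 0.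
Proof. by rewrite -dotp_wedge wedgexx dotp0r. Qed.

Lemma dotp_cs_mxC u X Y : dotp (X *m cs_mx s u) Y = - dotp X (Y *m cs_mx s u).
Proof. by rewrite -dotp_wedge wedgeC dotpNr dotp_wedge dotpC. Qed.

Lemma compatible_cs_mx u : dotp u u = 1 -> compatible_cs (cs_mx s u).
Proof.
move=> u1; split=> [|X Y]; last by rewrite dotp_mul_cs_mx u1 mul1r.
apply/row_matrixP => i; rewrite !rowE mulmxA mul_cs_mx2 u1 mulmxN mulmx1.
by rewrite scaleN1r.
Qed.

(** On a J-basis with u a unit vector the right side is 1, so s alone decides the orientation of all
    J-bases. *)
Lemma det_cs_mx_basis u (E : 'M[R]_4) :
  row 0 E *m cs_mx s u = row 1 E -> row 2 E *m cs_mx s u = row 3 E ->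
  s * \det E = dotp u u * (dotp (row 0 E) (row 0 E) * dotp (row 2 E) (row 2 E)
     - dotp (row 0 E) (row 2 E) ^+ 2) - dotp (row 1 E) (row 2 E) ^+ 2.
Proof.
move=> h1 h3.
have [a0 a1 a2 a3] := mul_cs_mxE s u (row 0 E).
have [b0 b1 b2 b3] := mul_cs_mxE s u (row 2 E).
rewrite h1 in a0 a1 a2 a3; rewrite h3 in b0 b1 b2 b3.
rewrite det4E; cbv zeta; rewrite !dotp4E dotp3E !mxE.
rewrite !mxE in a0 a1 a2 a3 b0 b1 b2 b3.
rewrite a0 a1 a2 a3 b0 b1 b2 b3.
by case: s_cases => ->; ring.
Qed.

Lemma signed_cs_mx u : dotp u u = 1 -> signed_cs s (cs_mx s u).
Proof.
move=> u1; split=> [|E [oE h1 h3]]; first exact: compatible_cs_mx.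
rewrite (det_cs_mx_basis h1 h3) u1 !oE/= expr0n/= subr0 !mul1r subr0.
exact: ltr01.
Qed.

Lemma exists_J_basis u : dotp u u = 1 -> exists E, J_basis (cs_mx s u) E.
Proof.
move=> u1; have [v v1 uv] := exists_orthogonal_unit u.
pose X : 'rV[R]_4 := delta_mx 0 0.
(* [X *m J] has coordinates (0, u), so u.v = 0 makes Y orthogonal to both X and [X *m J]. *)
pose Y : 'rV[R]_4 := \row_i [:: 0; v 0 0; v 0 1; v 0 2]`_i.
pose J := cs_mx s u.
have XX : dotp X X = 1 by rewrite dotp_delta mxE eqxx.
have YY : dotp Y Y = 1 by rewrite dotp4E !mxE/= mul0r add0r -dotp3E.
have XY : dotp X Y = 0 by rewrite dotp_delta mxE.
have JXY : dotp (X *m J) Y = 0.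
  by have [a0 a1 a2 a3] := mul_cs_mxE s u X;
     rewrite dotp4E a0 a1 a2 a3 !mxE/= -[RHS]uv dotp3E; ring.
have JJ Z T : dotp (Z *m J) (T *m J) = dotp Z T.
  by rewrite dotp_mul_cs_mx u1 mul1r.
have JZ Z : dotp (Z *m J) Z = 0 by exact: dotp_cs_mxx.
have XJY : dotp X (Y *m J) = 0.
  by apply/eqP; rewrite -oppr_eq0 -dotp_cs_mxC JXY.
pose E : 'M[R]_4 := \matrix_i nth 0 [:: X; X *m J; Y; Y *m J] i.
exists E; split; [|by rewrite !rowK..].
move=> i j; rewrite !rowK.
by case: i => [[|[|[|[|//]]]] ?]; case: j => [[|[|[|[|//]]]] ?] /=;
  rewrite ?JJ ?XX ?YY ?XY ?JXY ?XJY ?JZ ?(dotpC _ (_ *m J)) ?JZ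
    ?(dotpC Y) ?JJ ?XY ?JXY ?(dotpC _ X) ?XJY ?XY.
Qed.

End Sign.
End ComplexStructures.

(** * Every compatible complex structure is some [cs_mx t u] *)

Section Classification.
Variable R : realType.

Lemma compatible_cs_skew (J : 'M[R]_4) i j : compatible_cs J -> J i j = - J j i.
Proof.
move=> [J2 Jiso].
have e (X Y : 'rV[R]_4) : dotp (X *m J) Y = - dotp (Y *m J) X.
  rewrite -Jiso -mulmxA J2 mulmxN mulmx1 dotpNl; congr (- _); exact: dotpC.
have := e (delta_mx 0 i) (delta_mx 0 j).
by rewrite -!rowE !(dotpC (row _ J)) !dotp_delta !mxE.
Qed.

(* [t] is the Pfaffian of [J]. *)
Lemma compatible_csE (J : 'M[R]_4) : compatible_cs J ->
  exists t u, [/\ t ^+ 2 = 1, dotp u u = 1 & J = cs_mx t u].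
Proof.
move=> cJ; have sk i j := compatible_cs_skew i j cJ; have [J2 _] := cJ.
have diag i : J i i = 0.
  by apply/eqP; have /eqP := sk i i; rewrite -addr_eq0 -mulr2n mulrn_eq0.
have [e1 e2 e3] := ord4E.
have sq i j : J i 0 * J 0 j + J i 1 * J 1 j + J i 2 * J 2 j + J i 3 * J 3 j
    = - (i == j)%:R.
  have := congr1 (fun M : 'M[R]_4 => M i j) J2.
  rewrite /= mxE !big_ord_recl big_ord0 e1 e2 e3 addr0 !addrA => ->.
  by rewrite !mxE.
have s00 := sq 0 0; have s11 := sq 1 1; have s22 := sq 2 2; have s33 := sq 3 3.
have s01 := sq 0 1; have s02 := sq 0 2; have s03 := sq 0 3.
have s12 := sq 1 2; have s13 := sq 1 3; have s23 := sq 2 3.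
move: s00 s11 s22 s33 s01 s02 s03 s12 s13 s23; rewrite /= !diag.
rewrite (sk 1 0) (sk 2 0) (sk 3 0) (sk 2 1) (sk 3 1) (sk 3 2).
rewrite (_ : true%:R = 1)// (_ : false%:R = 0)// oppr0.
set a := J 0 1; set b := J 0 2; set c := J 0 3.
set d := J 1 2; set e := J 1 3; set f := J 2 3.
move=> s00 s11 s22 s33 s01 s02 s03 s12 s13 s23.
pose t := a * f - b * e + c * d.
have abc : a ^+ 2 + b ^+ 2 + c ^+ 2 = 1 by apply: oppr_inj; rewrite -s00; ring.
(* For f, e and d alike: after multiplication by a^2 + b^2 + c^2 = 1, the difference of the two
   sides is a combination of off-diagonal entries of J^2, which vanish. *)
have fE : f = t * a.
  rewrite -[f]mulr1 -abc /t; apply/eqP; rewrite -subr_eq0; apply/eqP.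
  transitivity (b * (b * f + a * e) + c * (c * f - a * d)); first by ring.
  have -> : b * f + a * e = 0 by rewrite -s03; ring.
  have -> : c * f - a * d = 0 by apply: oppr_inj; rewrite oppr0 -s02; ring.
  by rewrite !mulr0 addr0.
have eE : e = - (t * b).
  rewrite -[e]mulr1 -abc /t; apply/eqP; rewrite -subr_eq0; apply/eqP.
  transitivity (a * (a * e + b * f) + c * (c * e + b * d)); first by ring.
  have -> : a * e + b * f = 0 by rewrite -s03; ring.
  have -> : c * e + b * d = 0 by apply: oppr_inj; rewrite oppr0 -s01; ring.
  by rewrite !mulr0 addr0.
have dE : d = t * c.
  rewrite -[d]mulr1 -abc /t; apply/eqP; rewrite -subr_eq0; apply/eqP.
  transitivity (a * (a * d - c * f) + b * (b * d + c * e)); first by ring.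
  have -> : a * d - c * f = 0 by rewrite -s02; ring.
  have -> : b * d + c * e = 0 by apply: oppr_inj; rewrite oppr0 -s01; ring.
  by rewrite !mulr0 addr0.
exists t, (row3 a b c); split.
- have t2 : d ^+ 2 + e ^+ 2 + f ^+ 2 = t ^+ 2.
    by rewrite -[RHS]mulr1 -abc fE eE dE; ring.
  (* Sum of the last three diagonal entries of J^2 = -1, up to sign. *)
  have : (a ^+ 2 + b ^+ 2 + c ^+ 2) + 2 * (d ^+ 2 + e ^+ 2 + f ^+ 2) = 3.
    by move: s11 s22 s33 abc; clear; lra.
  by rewrite abc t2; lra.
- by rewrite dotp3E !row3E -abc; ring.
- apply/matrixP => i j; case: (ord4P i) => ->; case: (ord4P j) => ->;
    rewrite [RHS]mxE /= ?row3E ?diag//;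
    by [rewrite -/d dE | rewrite -/e eE mulNr | rewrite -/f fE | rewrite sk
      | rewrite sk -/d dE mulNr | rewrite sk -/e eE opprK
      | rewrite sk -/f fE mulNr].
Qed.

(** The classification yields J = [cs_mx t u] with t = 1 or -1; the determinant of a single J-basis,
    which exists, forces t = s. *)
Lemma signed_csP (s : R) J : s ^+ 2 = 1 ->
  signed_cs s J <-> exists2 u, dotp u u = 1 & J = cs_mx s u.
Proof.
move=> s2; split=> [[cJ posJ]|[u u1 ->]]; last exact: signed_cs_mx.
have [t [u [t2 u1 JE]]] := compatible_csE cJ; exists u => //.
have [E EJ] := exists_J_basis t2 u1.
have := (signed_cs_mx t2 u1).2 E EJ.
rewrite -JE in EJ; have := posJ E EJ.
move: s2 t2 => /eqP + /eqP; rewrite !sqrf_eq1.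
by move=> /orP[] /eqP sE /orP[] /eqP tE; rewrite JE sE tE//;
  move=> h1 h2; exfalso; clear -h1 h2; lra.
Qed.

End Classification.

(** * Differential calculus *)

Section Calculus.
Variable R : realType.

Lemma is_derive_line (V W : normedModType R) (f : V -> W) x v (r : R) df :
  is_derive (x + r *: v) v f df ->
  is_derive r 1 (fun r : R => f (x + r *: v)) df.
Proof.
move=> [fd <-].
have e : (fun h : R => h^-1 *: (((fun r : R => f (x + r *: v)) \o shift r) (h *: 1)
      - f (x + r *: v)))
    = (fun h => h^-1 *: ((f \o shift (x + r *: v)) (h *: v) - f (x + r *: v))).
  apply/funext => h /=; congr (_ *: (f _ - _)).
  by rewrite [_%:A]mulr1 scalerDl addrCA.
by apply: DeriveDef; rewrite /derivable /derive e.
Qed.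

(** The mean value theorem along v rewrites the second difference as t times a difference of values
    of F, which the differentiability of F at x estimates. *)
Lemma second_difference (V : normedModType R) (f F : V -> R) (x u v : V) :
  (\forall y \near x, is_derive y v f (F y)) -> differentiable F x ->
  forall e, 0 < e -> exists2 d, 0 < d & forall t, 0 < t < d ->
  `|f (x + t *: u + t *: v) - f (x + t *: v) - (f (x + t *: u) - f x)
    - t ^+ 2 * 'D_u F x| <= e * t ^+ 2.
Proof.
move=> fdiff Ddiff e e0.
pose M := `|u| + `|v| + 1.
have M0 : 0 < M by rewrite ltr_wpDl// addr_ge0.
have [d1 /= d1_0 Hd1] := (nbhs_ballP _ _).1 fdiff.
have e'0 : 0 < e / (2 * M) by rewrite divr_gt0// mulr_gt0.
have /eqaddoP /(_ _ e'0) := diff_locally Ddiff.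
move=> /nbhs_ballP [d2 /= d2_0 Hd2].
pose d := Num.min d1 d2 / M.
exists d; first by rewrite divr_gt0// lt_min d1_0.
move=> t /andP[t0 td].
have tM : t * M < d1 /\ t * M < d2.
  by move: td; rewrite /d ltr_pdivlMr// lt_min => /andP.
have nrm (a r : R) : 0 <= a <= t -> 0 <= r <= t -> `|a *: u + r *: v| <= t * M.
  move=> /andP[a0 at_] /andP[r0 rt].
  rewrite (le_trans (ler_normD _ _))// !normrZ !ger0_norm// /M !mulrDr.
  rewrite -[leLHS]addr0 lerD ?mulr1 ?(ltW t0)//.
  by rewrite lerD// ler_wpM2r.
have fder (a r : R) : 0 <= a <= t -> 0 <= r <= t ->
    is_derive r 1 (fun r : R => f (x + a *: u + r *: v))
      (F (x + a *: u + r *: v)).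
  move=> a0 r0; apply: is_derive_line; apply: Hd1.
  rewrite -ball_normE /ball_/= -addrA opprD addNKr normrN.
  by rewrite (le_lt_trans (nrm _ _ a0 r0)) ?tM.1.
(* The term [0 *: u] gives both points the same shape, so that [fder] and the estimate below apply
   with a = t and a = 0. *)
pose phi (r : R) := f (x + t *: u + r *: v) - f (x + 0 *: u + r *: v).
pose dphi (r : R) := F (x + t *: u + r *: v) - F (x + 0 *: u + r *: v).
have tt : 0 <= t <= t by rewrite ltW/=.
have z0 : 0 <= (0 : R) <= t by rewrite lexx ltW.
have phid (r : R) : 0 <= r <= t -> is_derive r 1 phi (dphi r).
  by move=> r0; apply: is_deriveB; exact: fder.
have [||r rt] := @MVT_segment R phi dphi 0 t (ltW t0).
- by move=> r /itvP rt; apply: phid; rewrite !rt.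
- apply: derivable_within_continuous => r rt.
  by apply: ex_derive; apply: phid; rewrite in_itv in rt.
rewrite in_itv/= in rt.
rewrite subr0 {1 2}/phi !scale0r !addr0 => ->.
have est (a : R) : 0 <= a <= t ->
    `|F (x + a *: u + r *: v) - F x - 'd F x (a *: u + r *: v)|
     <= e / 2 * t.
  move=> a0.
  have := Hd2 (a *: u + r *: v).
  rewrite -ball_normE /ball_/= sub0r normrN => /(_ _)/wrap[].
    exact: le_lt_trans (nrm _ _ a0 rt) tM.2.
  rewrite !fctE/= => h.
  rewrite -(addrA x) (addrC x) -(addrA (F _)) -opprD.
  apply: (le_trans h).
  have -> : e / 2 * t = e / (2 * M) * (t * M).
    by field; rewrite gt_eqF.
  by rewrite ler_wpM2l ?(ltW e'0)// nrm.
have h1 := est _ tt; have h2 := est _ z0.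
have -> : dphi r * t - t ^+ 2 * 'D_u F x =
  t * ((F (x + t *: u + r *: v) - F x - 'd F x (t *: u + r *: v))
  - (F (x + 0 *: u + r *: v) - F x - 'd F x (0 *: u + r *: v))).
  rewrite (deriveE _ Ddiff) !linearD !linearZ/= /dphi /GRing.scale/=; ring.
rewrite normrM gtr0_norm// expr2 mulrA (mulrC _ t) ler_pM2l//.
rewrite (le_trans (ler_normB _ _))// (le_trans (lerD h1 h2))//.
by rewrite le_eqVlt; apply/orP; left; apply/eqP; field.
Qed.

(** The second difference is symmetric in u and v, and for small t it lies within (e / 2) t^2 of t^2
    times either mixed derivative. *)
Lemma derive_comm (V : normedModType R) (f Fu Fv : V -> R) (x u v : V) :
  (\forall y \near x, is_derive y u f (Fu y)) ->
  (\forall y \near x, is_derive y v f (Fv y)) ->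
  differentiable Fu x -> differentiable Fv x ->
  'D_u Fv x = 'D_v Fu x.
Proof.
move=> fu fv ud vd; apply/eqP; rewrite -subr_eq0 -normr_eq0 eq_le normr_ge0 andbT.
apply/ler_addgt0Pr => e e0; rewrite add0r.
have e20 : 0 < e / 2 by rewrite divr_gt0.
have [d1 d1_0 H1] := second_difference u fv vd e20.
have [d2 d2_0 H2] := second_difference v fu ud e20.
pose t := Num.min d1 d2 / 2.
have t0 : 0 < t by rewrite divr_gt0// lt_min d1_0.
have tm : t < Num.min d1 d2 by rewrite ltr_pdivrMr// ltr_pMr ?lt_min ?d1_0// ltr1n.
move: tm; rewrite lt_min => /andP[td1 td2].
have {}H1 := H1 t; have {}H2 := H2 t; rewrite t0 td1 in H1; rewrite t0 td2 in H2.
have {}H1 := H1 isT; have {}H2 := H2 isT.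
have t20 : 0 < t ^+ 2 by rewrite exprn_gt0.
rewrite -(ler_pM2l t20) -{1}(gtr0_norm t20) -normrM mulrBr.
rewrite (addrAC x (t *: v)) in H2.
set a := f (x + _ + _) in H1 H2; set b := f (x + _) in H1 H2.
set c := f (x + _) in H1 H2.
move: ('D_u Fv x) ('D_v Fu x) H1 H2 => A B H1 H2.
have -> : t ^+ 2 * A - t ^+ 2 * B = (a - c - (b - f x) - t ^+ 2 * B)
    - (a - b - (c - f x) - t ^+ 2 * A) by ring.
apply: (le_trans (ler_normB _ _)); apply: (le_trans (lerD H2 H1)).
by rewrite le_eqVlt; apply/orP; left; apply/eqP; field.
Qed.

End Calculus.

(** * Derivatives of vector-valued maps; maps of constant direction *)

Section DeriveRow.
Variables (R : realType) (V : normedModType R).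
Implicit Types (x v : V).

Lemma is_derive_rowP n (F : V -> 'rV[R]_n) x v dF :
  is_derive x v F dF <-> forall i, is_derive x v (fun y => F y 0 i) (dF 0 i).
Proof.
split=> [[Fd <-] i|Fd].
  by apply: DeriveDef; [by move/derivable_mxP : Fd; exact|rewrite derive_mx// mxE].
have dF' : derivable F x v.
  by apply/derivable_mxP => i j; rewrite ord1; exact: ex_derive.
apply: DeriveDef => //; rewrite derive_mx//; apply/rowP => i; rewrite mxE.
exact: derive_val.
Qed.

Lemma is_derive_bigsum n (h : 'I_n -> V -> R) (dh : 'I_n -> R) x v :
  (forall i, is_derive x v (h i) (dh i)) ->
  is_derive x v (fun y => \sum_i h i y) (\sum_i dh i).
Proof.
move=> hd.
rewrite (_ : (fun y => _) = \sum_i h i); last by apply/funext => y; rewrite fct_sumE.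
exact: is_derive_sum.
Qed.

Lemma is_derive_mul (f g : V -> R) x v df dg :
  is_derive x v f df -> is_derive x v g dg ->
  is_derive x v (fun y => f y * g y) (df * g x + f x * dg).
Proof.
move=> fd gd; apply: is_derive_eq (is_deriveM fd gd) _.
by rewrite /GRing.scale/=; ring.
Qed.

Lemma is_derive_dotp n (F G : V -> 'rV[R]_n) x v dF dG :
  is_derive x v F dF -> is_derive x v G dG ->
  is_derive x v (fun y => dotp (F y) (G y)) (dotp dF (G x) + dotp (F x) dG).
Proof.
move=> /is_derive_rowP Fd /is_derive_rowP Gd.
rewrite (_ : (fun y => _) = fun y => \sum_i F y 0 i * G y 0 i); last first.
  by apply/funext => y; rewrite dotpE.
rewrite !dotpE -big_split/=; apply: is_derive_bigsum => i.
exact: is_derive_mul.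
Qed.

Lemma is_derive_mulmxr m n (F : V -> 'rV[R]_m) (A : 'M[R]_(m, n)) x v dF :
  is_derive x v F dF -> is_derive x v (fun y => F y *m A) (dF *m A).
Proof.
move=> /is_derive_rowP Fd; apply/is_derive_rowP => i.
rewrite (_ : (fun y => _) = fun y => \sum_j F y 0 j * A j i); last first.
  by apply/funext => y; rewrite mxE.
rewrite mxE; apply: is_derive_bigsum => j.
by apply: is_derive_eq (is_derive_mul (Fd j) (is_derive_cst _ _ _)) _;
  rewrite mulr0 addr0.
Qed.

Lemma is_derive_wedge s (F G : V -> 'rV[R]_4) x v dF dG :
  is_derive x v F dF -> is_derive x v G dG ->
  is_derive x v (fun y => wedge s (F y) (G y))
    (wedge s dF (G x) + wedge s (F x) dG).
Proof.
move=> Fd Gd; apply/is_derive_rowP => i.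
rewrite (_ : (fun y => _) =
    fun y => dotp (F y *m cs_mx s (delta_mx 0 i)) (G y)); last first.
  by apply/funext => y; rewrite -dotp_wedge dotp_delta.
apply: is_derive_eq (is_derive_dotp (is_derive_mulmxr _ Fd) Gd) _.
by rewrite -!dotp_wedge -dotpDr dotp_delta.
Qed.

Lemma differentiable_bigsum n (h : 'I_n -> V -> R) x :
  (forall i, differentiable (h i) x) -> differentiable (fun y => \sum_i h i y) x.
Proof.
move=> hd.
rewrite (_ : (fun y => _) = \sum_i h i); last by apply/funext => y; rewrite fct_sumE.
exact: differentiable_sum.
Qed.

Lemma differentiable_coordinate n (F : V -> 'rV[R]_n) i x :
  differentiable F x -> differentiable (fun y => F y 0 i) x.
Proof.
move=> Fd; apply: (@differentiable_comp _ _ _ _ F (fun M : 'rV[R]_n => M 0 i)) => //.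
exact: differentiable_coord.
Qed.

Lemma differentiable_dotp_wedge s a (F G : V -> 'rV[R]_4) x :
  differentiable F x -> differentiable G x ->
  differentiable (fun y => dotp a (wedge s (F y) (G y))) x.
Proof.
move=> Fd Gd.
rewrite (_ : (fun y => _) =
    fun y => \sum_i (\sum_j F y 0 j * cs_mx s a j i) * G y 0 i); last first.
  by apply/funext => y; rewrite dotp_wedge dotpE; apply: eq_bigr => i _; rewrite mxE.
apply: differentiable_bigsum => i; apply: differentiableM.
  apply: differentiable_bigsum => j; apply: differentiableM.
    exact: differentiable_coordinate.
  exact: differentiable_cst.
exact: differentiable_coordinate.
Qed.

(** Differentiating the hypothesis gives (a.W)(a.dW) = C (W.dW), which shows that a.W times the
    claimed quantity is zero. *)
Lemma constant_angle_perp (W : V -> 'rV[R]_3) x v dW a C :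
  W x != 0 -> is_derive x v W dW ->
  (\forall y \near x, dotp a (W y) ^+ 2 = C * dotp (W y) (W y)) ->
  dotp a (perp (W x) dW) = 0.
Proof.
move=> W0 Wd aW.
have ad : is_derive x v (fun y => dotp a (W y)) (dotp a dW).
  apply: is_derive_eq (is_derive_dotp (is_derive_cst a _ _) Wd) _.
  by rewrite dotp0l add0r.
have ad2 := is_derive_mul ad ad.
have wd := is_derive_mul (is_derive_cst C x v) (is_derive_dotp Wd Wd).
have e : dotp a (W x) * dotp a dW = C * dotp (W x) dW.
  have : 'D_v (fun y => dotp a (W y) * dotp a (W y)) x =
         'D_v (fun y => cst C y * dotp (W y) (W y)) x.
    by apply: near_eq_derive; apply: filterS aW => y; rewrite expr2.
  rewrite !derive_val mul0r add0r (dotpC dW) /cst.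
  by move=> h; lra.
rewrite /perp dotpBr !dotpZr.
have aWx := nbhs_singleton aW.
(* If a.W vanishes at x, then C = 0, so a.W vanishes near x and its derivative is zero. *)
have [m0|m0] := eqVneq (dotp a (W x)) 0.
  rewrite m0 mulr0 subr0.
  have C0 : C = 0.
    move: aWx; rewrite m0 expr0n/= => /esym/eqP; rewrite mulf_eq0 dotp_eq0.
    by rewrite (negbTE W0) orbF => /eqP.
  suff -> : dotp a dW = 0 by rewrite mulr0.
  rewrite -(@derive_val _ _ _ _ _ _ _ ad) -(derive_cst (0 : R) x v).
  apply: near_eq_derive; apply: filterS aW => y.
  by rewrite C0 mul0r => /eqP; rewrite sqrf_eq0 => /eqP.
apply: (mulfI m0); rewrite mulr0.
transitivity (dotp (W x) (W x) * (dotp a (W x) * dotp a dW)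
    - dotp (W x) dW * dotp a (W x) ^+ 2); first by ring.
by rewrite e aWx; ring.
Qed.

(* The ratio of two coordinates of [W] is constant along segments. *)
Lemma perp0_locally_parallel (W : V -> 'rV[R]_3) (dW : V -> V -> 'rV[R]_3) x :
  W x != 0 -> {for x, continuous (fun y => dotp (W x) (W y))} ->
  (\forall y \near x, forall v,
     is_derive y v W (dW y v) /\ perp (W y) (dW y v) = 0) ->
  \forall y \near x, exists2 l, 0 < l & W y = l *: W x.
Proof.
move=> W0 dotpc Wd.
have xx : 0 < dotp (W x) (W x) by rewrite dotp_gt0.
have pos : \forall y \near x, 0 < dotp (W x) (W y).
  exact: (cvgr_gt _ dotpc).
have [d /= d0 Hd] := (nbhs_ballP _ _).1 (filterI Wd pos).
apply/nbhs_ballP; exists d => //= y xy.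
have seg (r : R) : 0 <= r <= 1 -> ball x d (x + r *: (y - x)).
  move=> /andP[r0 r1].
  rewrite -ball_normE/= opprD addNKr normrN normrZ ger0_norm//.
  rewrite -ball_normE/= distrC in xy; apply: le_lt_trans xy.
  by rewrite ler_piMl.
have yE : x + 1 *: (y - x) = y by rewrite scale1r addrC subrK.
have ypos := (Hd _ xy).2.
have const a : dotp a (W y) / dotp (W x) (W y)
    = dotp a (W x) / dotp (W x) (W x).
  pose v := y - x.
  pose q z := dotp a (W z) / dotp (W x) (W z).
  have qd z : ball x d z -> is_derive z v q 0.
    move=> /Hd [/(_ v) [Wdz]]; move: (dW z v) Wdz => dz Wdz pz zpos.
    have ad b : is_derive z v (fun y => dotp b (W y)) (dotp b dz).
      apply: is_derive_eq (is_derive_dotp (is_derive_cst b _ _) Wdz) _.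
      by rewrite dotp0l add0r.
    have zn0 : dotp (W x) (W z) != 0 by rewrite gt_eqF.
    have Vd : is_derive z v (fun y => (dotp (W x) (W y))^-1)
        (- (dotp (W x) (W z)) ^- 2 *: dotp (W x) dz).
      have [xd xE] := ad (W x).
      by apply: DeriveDef; [exact: derivableV|rewrite deriveV// xE].
    apply: is_derive_eq (is_derive_mul (ad a) Vd) _.
    have Wz0 : dotp (W z) (W z) != 0.
      rewrite dotp_eq0; apply: contraTneq zpos => ->.
      by rewrite dotp0r ltxx.
    (* As dW is a multiple of W, the numerator and the denominator of q vary with the same factor,
       and q has derivative 0. *)
    have dzE : dz = (dotp (W z) dz / dotp (W z) (W z)) *: W z.
      apply: (scalerI Wz0); rewrite scalerA mulrCA divff// mulr1.
      exact/subr0_eq.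
    move: (_ / _) dzE => k ->; rewrite !dotpZr /GRing.scale/=.
    by field.
  have [||r rI] := @MVT_segment R (fun r : R => q (x + r *: v)) (fun=> 0) 0 1 ler01.
  - move=> r /itvP rI; apply: is_derive_line; apply: qd; apply: seg.
    by rewrite !rI.
  - apply: derivable_within_continuous => r rI.
    apply: ex_derive; apply: is_derive_line; apply: qd; apply: seg.
    by rewrite in_itv in rI.
  rewrite mul0r scale0r addr0 yE => /eqP.
  by rewrite subr_eq0 => /eqP.
exists (dotp (W x) (W y) / dotp (W x) (W x)); first by rewrite divr_gt0.
have ny : dotp (W x) (W y) != 0 by rewrite gt_eqF.
have nx : dotp (W x) (W x) != 0 by rewrite gt_eqF.
apply/rowP => i; have := const (delta_mx 0 i); rewrite !dotp_delta mxE => h.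
by rewrite -[LHS](divfK ny) h; field.
Qed.

End DeriveRow.

(** * Immersed surfaces in coordinates *)

(* Locked, as unification would otherwise unfold [derive] to a limit when
   comparing two distinct directional derivatives. *)
HB.lock Definition dirder (R : realType) (V W : normedModType R) (v : V)
  (f : V -> W) : V -> W := 'D_v f.

Section LocalSurface.
Variables (R : realType) (g : 'rV[R]_2 -> 'rV[R]_4) (U : set 'rV[R]_2).
Hypotheses (U_open : open U) (g_smooth : smooth_on U g).
Hypothesis g_imm : forall x, U x -> injective ('d g x).
Implicit Types (x v : 'rV[R]_2).

Local Notation e i := (delta_mx 0 i : 'rV[R]_2).
Local Notation g0 := (dirder (e 0) g).
Local Notation g1 := (dirder (e 1) g).

Lemma dirderE v (f : 'rV[R]_2 -> 'rV[R]_4) : dirder v f = 'D_v f.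
Proof. by rewrite unlock. Qed.

Lemma smooth_diff x : U x -> differentiable g x.
Proof. exact: (g_smooth [::]). Qed.

Lemma smooth_diff_dirder v x : U x -> differentiable (dirder v g) x.
Proof. by rewrite dirderE; exact: (g_smooth [:: v]). Qed.

Lemma is_derive_dirder v (f : 'rV[R]_2 -> 'rV[R]_4) x :
  differentiable f x -> is_derive x v f (dirder v f x).
Proof. by rewrite dirderE => fx; exact/derivableP/diff_derivable. Qed.

Lemma near_open x : U x -> \forall y \near x, U y.
Proof. by move=> Ux; apply: (@open_nbhs_nbhs _ x U). Qed.

Lemma dirder_diff v (f : 'rV[R]_2 -> 'rV[R]_4) x :
  differentiable f x -> dirder v f x = 'd f x v.
Proof. by move=> fx; rewrite dirderE deriveE. Qed.

Lemma dirder_comb u v a b (f : 'rV[R]_2 -> 'rV[R]_4) x :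
  differentiable f x ->
  dirder (a *: u + b *: v) f x = a *: dirder u f x + b *: dirder v f x.
Proof. by move=> fx; rewrite !dirder_diff// linearD !linearZ. Qed.

Lemma row_jacobian x i : U x -> row i ('J g x) = dirder (e i) g x.
Proof. by move=> /smooth_diff gx; rewrite dirderE deriveEjacobian// rowE. Qed.

Lemma smooth_dirder_comm u v x :
  U x -> dirder u (dirder v g) x = dirder v (dirder u g) x.
Proof.
move=> Ux.
have near_comp w i : \forall y \near x,
    is_derive y w (fun z => g z 0 i) (dirder w g y 0 i).
  apply: filterS (near_open Ux) => y Uy; apply: (is_derive_rowP _ _ _ _).1.
  exact/is_derive_dirder/smooth_diff.
have diffc w i : differentiable (fun z => dirder w g z 0 i) x.
  exact/differentiable_coordinate/smooth_diff_dirder.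
apply/rowP => i.
have mixed w z : dirder w (dirder z g) x 0 i = 'D_w (fun y => dirder z g y 0 i) x.
  apply/esym; apply: derive_val; apply: (is_derive_rowP _ _ _ _).1.
  exact/is_derive_dirder/smooth_diff_dirder.
have comm := derive_comm (near_comp u i) (near_comp v i) (diffc u i) (diffc v i).
exact: etrans (mixed u v) (etrans comm (esym (mixed v u))).
Qed.

(* A positive multiple of the component [G+] or [G-] of the Gauss map. *)
Definition gauss (s : R) x := row_wedge s ('J g x).

Lemma gaussE s x : U x -> gauss s x = wedge s (g0 x) (g1 x).
Proof. by move=> Ux; rewrite /gauss /row_wedge !row_jacobian. Qed.

Definition dgauss (s : R) x v :=
  wedge s (dirder v g0 x) (g1 x) + wedge s (g0 x) (dirder v g1 x).

Lemma is_derive_gauss s x v : U x -> is_derive x v (gauss s) (dgauss s x v).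
Proof.
move=> Ux; apply: (near_eq_is_derive (f := fun y => wedge s (g0 y) (g1 y))).
  by apply: filterS (near_open Ux) => y Uy; rewrite gaussE.
by apply: is_derive_wedge; exact/is_derive_dirder/smooth_diff_dirder.
Qed.

Lemma continuous_dotp_gauss s a x : U x ->
  {for x, continuous (fun y => dotp a (gauss s y))}.
Proof.
move=> Ux.
have h : dotp a (wedge s (g0 y) (g1 y)) @[y --> x]
    --> dotp a (wedge s (g0 x) (g1 x)).
  exact: (differentiable_continuous (differentiable_dotp_wedge s a
    (smooth_diff_dirder (e 0) Ux) (smooth_diff_dirder (e 1) Ux))).
rewrite -gaussE// in h.
have near_eq : \forall y \near x,
    dotp a (wedge s (g0 y) (g1 y)) = dotp a (gauss s y).
  by apply: filterS (near_open Ux) => y Uy; rewrite gaussE.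
exact: cvg_trans (near_eq_cvg near_eq) h.
Qed.

Lemma dgauss_comb s x u v a b : U x ->
  dgauss s x (a *: u + b *: v) = a *: dgauss s x u + b *: dgauss s x v.
Proof.
move=> Ux; rewrite /dgauss !dirder_comb; try exact: smooth_diff_dirder.
by rewrite !(wedgeDl, wedgeDr, wedgeZl, wedgeZr) !scalerDr addrACA.
Qed.

Section Sign.
Variables (s : R) (s2 : s ^+ 2 = 1).
Local Notation w := (gauss s).
Local Notation dw := (dgauss s).

Lemma g0_neq0 x : U x -> g0 x != 0.
Proof.
move=> Ux; apply/eqP => g00.
have : 'd g x (e 0) = 'd g x 0.
  by rewrite linear0 -dirder_diff//; exact: smooth_diff.
move/(g_imm Ux)/(congr1 (fun v : 'rV[R]_2 => v 0 0)); rewrite !mxE/=.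
by move/eqP; rewrite oner_eq0.
Qed.

Lemma gauss_neq0 x : U x -> w x != 0.
Proof.
move=> Ux; apply/eqP => w0.
have pp0 : dotp (g0 x) (g0 x) != 0 by rewrite dotp_eq0 g0_neq0.
have wn : dotp (g0 x) (g0 x) * dotp (g1 x) (g1 x) - dotp (g0 x) (g1 x) ^+ 2 = 0.
  by rewrite -(wedge_norm s2) -gaussE// w0 dotp0r.
(* The differential kills this vector when the Gram determinant is zero, yet its second coordinate
   -|g0|^2 is not zero. *)
pose v := dotp (g0 x) (g1 x) *: e 0 - dotp (g0 x) (g0 x) *: e 1.
have gv : 'd g x v = dotp (g0 x) (g1 x) *: g0 x - dotp (g0 x) (g0 x) *: g1 x.
  by rewrite linearB !linearZ/= -!dirder_diff//; exact: smooth_diff.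
have : 'd g x v = 'd g x 0.
  rewrite linear0 gv; apply/eqP; rewrite -dotp_eq0.
  rewrite !(dotpDl, dotpDr, dotpNl, dotpNr, dotpZl, dotpZr) (dotpC (g1 x) (g0 x)).
  by apply/eqP; rewrite -[RHS](mulr0 (dotp (g0 x) (g0 x))) -wn; ring.
move/(g_imm Ux)/(congr1 (fun v : 'rV[R]_2 => v 0 1)); rewrite !mxE/=.
rewrite mulr0 mulr1 sub0r => /eqP.
by rewrite oppr_eq0 (negbTE pp0).
Qed.

(** By the explicit inverse of the first form, the mean curvature vector is the normal part of
    [curvature_comb] divided by twice the determinant of that form. *)
Lemma mean_curvature_eq0 x : U x -> mean_curvature g x = 0 <->
  exists a b, curvature_comb (g0 x) (g1 x) (dirder (e 0) g0 x) (dirder (e 0) g1 x)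
    (dirder (e 1) g1 x) = a *: g0 x + b *: g1 x.
Proof.
move=> Ux.
pose M := first_form g x.
(* Orthogonal projection onto the normal plane, acting on the right; its kernel is the tangent
   plane. *)
pose K : 'M[R]_4 := 1%:M - ('J g x)^T *m invmx M *m 'J g x.
have normalE (z : 'rV[R]_4) : normal_part g x z = z *m K.
  by rewrite /K mulmxBr mulmx1 !mulmxA.
have ME i j : M i j = dotp (dirder (e i) g x) (dirder (e j) g x).
  rewrite -!row_jacobian// dotpE /M /first_form mxE.
  by apply: eq_bigr => k _; rewrite !mxE.
have MC : M 1 0 = M 0 1 by rewrite !ME dotpC.
have detM : \det M != 0.
  rewrite det2E MC !ME -expr2 -(wedge_norm s2) dotp_eq0 -gaussE//.
  exact: gauss_neq0.
have Munit : M \in unitmx by rewrite unitmxE unitfE.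
have [i00 i01 i10 i11] := invmx2E detM.
have sE i j : second_form g x i j = dirder (e i) (dirder (e j) g) x *m K.
  by rewrite /second_form normalE !dirderE.
set H := curvature_comb _ _ _ _ _.
have HE : mean_curvature g x = (2 * \det M)^-1 *: (H *m K).
  rewrite /mean_curvature.
  under eq_bigr => i _.
    under eq_bigr => j _ do rewrite sE.
    rewrite sum_ord2.
    over.
  rewrite sum_ord2 /= -/M.
  rewrite !scalemxAl -!mulmxDl scalemxAl; congr (_ *m _).
  rewrite i00 i01 i10 i11 (smooth_dirder_comm (e 1) (e 0) Ux) MC !ME /H.
  rewrite /curvature_comb; apply/rowP => i; rewrite !mxE.
  by field.
have JK : 'J g x *m K = 0.
  rewrite mulmxBr mulmx1 !mulmxA -/(first_form g x) -/M.
  by rewrite mulmxV// mul1mx subrr.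
have rowK0 i : dirder (e i) g x *m K = 0.
  by rewrite -row_jacobian// -row_mul JK row0.
rewrite HE; split=> [/eqP|[a [b ->]]]; last first.
  by rewrite mulmxDl -!scalemxAl !rowK0 !scaler0 addr0 scaler0.
rewrite scaler_eq0 invr_eq0 mulf_eq0 pnatr_eq0 (negbTE detM)/=.
rewrite mulmxBr mulmx1 !mulmxA subr_eq0 => /eqP ->.
set z := _ *m invmx M; exists (z 0 0), (z 0 1).
by rewrite mulmx_sum_row sum_ord2 !row_jacobian.
Qed.

Lemma perp_dgauss0 x : U x ->
  perp (w x) (dw x (e 0)) = 0 -> perp (w x) (dw x (e 1)) = 0 ->
  forall v, perp (w x) (dw x v) = 0.
Proof.
move=> Ux h0 h1 v; rewrite [v]row_sum_delta sum_ord2 dgauss_comb//.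
move: h0 h1; move: (dw x (e 0)) (dw x (e 1)) (w x) => y z t.
rewrite /perp => h0 h1; rewrite !(dotpDr, dotpZr).
transitivity (v 0 0 *: (dotp t t *: y - dotp t y *: t)
  + v 0 1 *: (dotp t t *: z - dotp t z *: t)).
  by apply/rowP => i; rewrite !mxE; ring.
by rewrite h0 h1 !scaler0 addr0.
Qed.

Lemma constant_angle_dgauss a C x v :
  (forall y, U y -> dotp a (w y) ^+ 2 = C * dotp (w y) (w y)) -> U x ->
  dotp a (perp (w x) (dw x v)) = 0.
Proof.
move=> aw Ux; apply: (constant_angle_perp (C := C)).
- exact: gauss_neq0.
- exact: is_derive_gauss.
- by apply: filterS (near_open Ux) => y; exact: aw.
Qed.

(** Since |u x w|^2 = (1 - C) |w|^2, the vectors u and w are parallel everywhere or nowhere on U.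
    Minimality enters in the second case, through [tangent_curvature_comb]. *)
Lemma minimal_constant_angle u C :
  (forall x, U x -> mean_curvature g x = 0) -> dotp u u = 1 ->
  (forall x, U x -> dotp u (w x) ^+ 2 = C * dotp (w x) (w x)) ->
  forall x v, U x -> perp (w x) (dw x v) = 0.
Proof.
move=> gmin u1 uw x v Ux.
have uperp z := constant_angle_dgauss z uw Ux.
have uwE y : U y -> dotp (cross u (w y)) (cross u (w y))
    = (1 - C) * dotp (w y) (w y).
  by move=> Uy; rewrite cross_norm u1 uw//; ring.
have [C1|C1] := eqVneq C 1.
  (* Here [w] is everywhere parallel to [u]. *)
  suff perp0 a : dotp a (perp (w x) (dw x v)) = 0.
    by apply/eqP; rewrite -dotp_eq0 perp0.
  (* The part of a orthogonal to u is orthogonal to w on U, hence to the vector to be killed; u is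
     orthogonal to that vector by [uperp]. *)
  pose a' := a - dotp a u *: u.
  have a'w y : U y -> dotp a' (w y) ^+ 2 = 0 * dotp (w y) (w y).
    move=> Uy; rewrite mul0r; have := uwE y Uy.
    rewrite C1 subrr mul0r => /eqP; rewrite dotp_eq0 => /eqP /cross_eq0.
    rewrite u1 scale1r => ->; rewrite dotpZr dotpBl dotpZl u1 mulr1 subrr.
    by rewrite mulr0 expr0n.
  have := constant_angle_dgauss v a'w Ux.
  by rewrite dotpBl dotpZl uperp mulr0 subr0.
have uw0 : cross u (w x) != 0.
  by rewrite -dotp_eq0 uwE// mulf_neq0 ?dotp_eq0 ?gauss_neq0// subr_eq0 eq_sym.
have H := (mean_curvature_eq0 Ux).1 (gmin x Ux).
have comm := smooth_dirder_comm (e 0) (e 1) Ux.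
have [] := tangent_curvature_comb s2 H (g0_neq0 Ux) _ (u := u).
- by rewrite -gaussE.
- by have := uperp (e 0); rewrite gaussE.
- by have := uperp (e 1); rewrite /dgauss -comm gaussE.
- by move=> h0 h1; apply: perp_dgauss0 => //; rewrite /dgauss -?comm gaussE.
Qed.

(** The angles with u and u' fix the square of the triple product with w, so the derivative of the
    direction of w is orthogonal to u, u' and u x u'. The mixed term of the Gram determinant calls
    for the signed cosines, hence the square roots in the hypotheses. *)
Lemma two_angles_minimal u u' k k' :
  dotp u u = 1 -> dotp u' u' = 1 -> cross u u' != 0 ->
  (forall x, U x -> dotp u (w x) = k * Num.sqrt (dotp (w x) (w x))) ->
  (forall x, U x -> dotp u' (w x) = k' * Num.sqrt (dotp (w x) (w x))) ->
  forall x, U x -> mean_curvature g x = 0.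
Proof.
move=> u1 u'1 uu' uw u'w x Ux.
have sqrt2 y : Num.sqrt (dotp (w y) (w y)) ^+ 2 = dotp (w y) (w y).
  by rewrite sqr_sqrtr// dotp_ge0.
have uw2 y : U y -> dotp u (w y) ^+ 2 = k ^+ 2 * dotp (w y) (w y).
  by move=> Uy; rewrite uw// exprMn sqrt2.
have u'w2 y : U y -> dotp u' (w y) ^+ 2 = k' ^+ 2 * dotp (w y) (w y).
  by move=> Uy; rewrite u'w// exprMn sqrt2.
(* The Gram determinant of u, u' and w / |w|. *)
pose C := 1 - dotp u u' ^+ 2 - k ^+ 2 - k' ^+ 2 + 2 * (dotp u u' * k * k').
have uu'w2 y : U y -> dotp (cross u u') (w y) ^+ 2 = C * dotp (w y) (w y).
  move=> Uy; rewrite triple_product_sqr u1 u'1 uw2// u'w2// uw// u'w//.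
  by have := sqrt2 y; move: (Num.sqrt _) => r <-; rewrite /C; ring.
have perp0 v : perp (w x) (dw x v) = 0.
  apply: (orthogonal_frame_eq0 uu').
  - exact: constant_angle_dgauss uw2 Ux.
  - exact: constant_angle_dgauss u'w2 Ux.
  - exact: constant_angle_dgauss uu'w2 Ux.
apply/(mean_curvature_eq0 Ux).
have comm := smooth_dirder_comm (e 0) (e 1) Ux.
apply: (perp0_tangent_curvature_comb s2).
- by rewrite -gaussE// gauss_neq0.
- by have := perp0 (e 0); rewrite gaussE.
- by have := perp0 (e 1); rewrite gaussE// /dgauss -comm.
Qed.

End Sign.

End LocalSurface.

(** * Oriented surfaces *)

Section UnitVectors.
Variable R : realType.
Implicit Types u v : 'rV[R]_3.

Lemma dotp_unit_itv u v :
  dotp u u = 1 -> dotp v v = 1 -> -1 <= dotp u v <= 1.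
Proof.
move=> u1 v1; have := dotp_ge0 (cross u v).
rewrite cross_norm u1 v1 mulr1 subr_ge0.
by move: (dotp u v) => d; clear => d2; apply/andP; split; nra.
Qed.

Lemma unit_cross_eq0 u v :
  dotp u u = 1 -> dotp v v = 1 -> cross u v = 0 -> v = u \/ v = - u.
Proof.
move=> u1 v1 /cross_eq0; rewrite u1 scale1r => vE.
move: v1; rewrite vE dotpZl dotpZr u1 mulr1 -expr2 => /eqP.
rewrite sqrf_eq1 => /orP[] /eqP ->; first by left; rewrite scale1r.
by right; rewrite scaleN1r.
Qed.

Definition pos_parallel u v := exists2 l, 0 < l & u = l *: v.

Lemma pos_parallel_refl u : pos_parallel u u.
Proof. by exists 1; rewrite ?scale1r. Qed.

Lemma pos_parallel_sym u v : pos_parallel u v -> pos_parallel v u.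
Proof.
move=> [l l0 ->]; exists l^-1; first by rewrite invr_gt0.
by rewrite scalerA mulVf ?scale1r// gt_eqF.
Qed.

Lemma pos_parallel_trans v u w :
  pos_parallel u v -> pos_parallel v w -> pos_parallel u w.
Proof.
move=> [l l0 ->] [k k0 ->]; exists (l * k); first by rewrite mulr_gt0.
by rewrite scalerA.
Qed.

Lemma unit_pos_parallel_eq u v :
  dotp u u = 1 -> dotp v v = 1 -> pos_parallel u v -> u = v.
Proof.
move=> u1 v1 [l l0 uv]; move: u1; rewrite uv dotpZl dotpZr v1 mulr1 -expr2.
move=> /eqP; rewrite sqrf_eq1 => /orP[/eqP->|/eqP l1]; first by rewrite scale1r.
by move: l0; rewrite l1 oppr_gt0 ltr10.
Qed.

End UnitVectors.

Section Charts.
Variables (R : realType) (N : topologicalType) (c : chart R N).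

Lemma chart_map_continuous p : chart_dom c p -> {for p, continuous (chart_map c)}.
Proof.
move=> cp; have := @chart_map_cts _ _ c.
by rewrite continuous_open_subspace; [apply; rewrite inE|exact: chart_dom_open].
Qed.

Lemma chart_inv_continuous p :
  chart_dom c p -> {for chart_map c p, continuous (chart_inv c)}.
Proof.
move=> cp; have := @chart_inv_cts _ _ c.
rewrite continuous_open_subspace; last exact: chart_cod_open.
by apply; rewrite inE; exists p.
Qed.

Lemma near_chart_dom p : chart_dom c p -> \forall q \near p, chart_dom c q.
Proof.
by move=> cp; apply: (@open_nbhs_nbhs _ p (chart_dom c)); split => //;
  exact: chart_dom_open.
Qed.

Lemma near_chart_cod p : chart_dom c p ->
  \forall y \near chart_map c p, (chart_map c @` chart_dom c) y.
Proof.
move=> cp; apply: (@open_nbhs_nbhs _ _ (chart_map c @` chart_dom c)).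
by split; [exact: chart_cod_open|exists p].
Qed.

End Charts.

(** * The Gauss map of an immersed surface, and slantness in terms of it *)

Section Immersion.
Variables (R : realType) (N : oriented_surface R) (f : N -> 'rV[R]_4).
Hypothesis f_imm : immersion f.
Implicit Types (c d : chart R N) (p q : N).

(** Chain rule for [local_rep f c = local_rep f d \o t], which holds near the point because
    [chart_inv c] is continuous there. *)
Lemma transition_jacobian c d p :
  atlas c -> atlas d -> chart_dom c p -> chart_dom d p ->
  exists2 T : 'M[R]_2, 0 < \det T &
    'J (local_rep f c) (chart_map c p) = T *m 'J (local_rep f d) (chart_map d p).
Proof.
move=> Ac Ad cp dp.
have [_ /(_ c d Ac Ad) /= [t_smooth t_det]] := atlas_oriented N.
set t := chart_map d \o chart_inv c in t_smooth t_det.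
set x := chart_map c p.
have Ux : (chart_map c @` (chart_dom c `&` chart_dom d)) x by exists p.
have tx : t x = chart_map d p by rewrite /t /= chart_mapK.
exists ('J t x); first exact: t_det.
have dt : differentiable t x := t_smooth [::] x Ux.
have [smooth_d _] := f_imm Ad.
have dd : differentiable (local_rep f d) (t x).
  by apply: (smooth_d [::]); rewrite tx; exists p.
have [smooth_c _] := f_imm Ac.
have dc : differentiable (local_rep f c) x by apply: (smooth_c [::]); exists p.
have near_eq : \forall y \near x, local_rep f c y = (local_rep f d \o t) y.
  have inv_d : \forall y \near x, chart_dom d (chart_inv c y).
    apply: (chart_inv_continuous cp); rewrite chart_mapK//.
    exact: near_chart_dom.
  apply: filterS2 (near_chart_cod cp) inv_d => y [q cq <-].
  by rewrite /local_rep /t /= (chart_mapK cq) => dq; rewrite (chart_mapK dq).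
apply/row_matrixP => i; rewrite row_mul !rowE -tx -!deriveEjacobian//.
rewrite (near_eq_derive _ near_eq) deriveE; last exact: differentiable_comp.
by rewrite diff_comp//= deriveE// deriveE.
Qed.

Definition gauss_at (s : R) c p := gauss (local_rep f c) s (chart_map c p).

Lemma gauss_at_transition s c d p :
  atlas c -> atlas d -> chart_dom c p -> chart_dom d p ->
  pos_parallel (gauss_at s c p) (gauss_at s d p).
Proof.
move=> Ac Ad cp dp; have [T T0 TE] := transition_jacobian Ac Ad cp dp.
by exists (\det T) => //; rewrite /gauss_at /gauss TE row_wedge_mul.
Qed.

Section Sign.
Variables (s : R) (s2 : s ^+ 2 = 1).

Lemma gauss_at_neq0 c p : atlas c -> chart_dom c p -> gauss_at s c p != 0.
Proof.
move=> Ac cp; have [sm inj] := f_imm Ac.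
by apply: (gauss_neq0 sm inj s2); exists p.
Qed.

Lemma positive_tangent_onb_exists c p : atlas c -> chart_dom c p ->
  exists P : 'M[R]_2, [/\ 0 < \det P,
    positive_tangent_onb f p (P *m 'J (local_rep f c) (chart_map c p)) &
    row_wedge s (P *m 'J (local_rep f c) (chart_map c p))
      = \det P *: gauss_at s c p].
Proof.
move=> Ac cp; have [P P0 oP] := gram_schmidt s2 (gauss_at_neq0 Ac cp).
exists P; split=> //; last exact: row_wedge_mul.
by split=> //; exists c; split=> //; exists P.
Qed.

Lemma positive_tangent_onb_gauss p E : positive_tangent_onb f p E ->
  exists c, [/\ atlas c, chart_dom c p &
    pos_parallel (row_wedge s E) (gauss_at s c p)].
Proof.
move=> [_ [c [Ac cp [P P0 ->]]]]; exists c; split=> //.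
by exists (\det P) => //; exact: row_wedge_mul.
Qed.

Lemma plane_angle_cs_mx u E :
  plane_angle (cs_mx s u) E = acos (dotp u (row_wedge s E)).
Proof. by rewrite /plane_angle dotp_wedge. Qed.

(** An orthonormal frame has a unit [row_wedge], so the determinant of its change of basis P is the
    inverse of the length of the Gauss vector. *)
Lemma alpha_slant_gauss u alpha c p : dotp u u = 1 ->
  alpha_slant f (cs_mx s u) alpha -> atlas c -> chart_dom c p ->
  dotp u (gauss_at s c p) =
  cos alpha * Num.sqrt (dotp (gauss_at s c p) (gauss_at s c p)).
Proof.
move=> u1 slant_u Ac cp.
have [P [P0 oP PE]] := positive_tangent_onb_exists Ac cp.
have w1 := orthonormal_row_wedge s2 oP.1.
have := slant_u _ _ oP; rewrite plane_angle_cs_mx.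
move/(congr1 (@cos R)); rewrite acosK ?in_itv/= ?dotp_unit_itv// => <-.
move: w1; rewrite PE dotpZr dotpZl dotpZr mulrA -expr2.
set n := dotp (gauss_at s c p) _ => n1.
have n0 : 0 <= n by exact: dotp_ge0.
have r1 : \det P * Num.sqrt n = 1.
  rewrite -(gtr0_norm P0) -sqrtr_sqr -sqrtrM ?sqr_ge0// n1.
  exact: sqrtr1.
by rewrite mulrAC r1 mul1r.
Qed.

Lemma gauss_at_locally_parallel c p : atlas c -> chart_dom c p ->
  (forall x v, (chart_map c @` chart_dom c) x ->
     perp (gauss (local_rep f c) s x) (dgauss (local_rep f c) s x v) = 0) ->
  \forall q \near p,
    chart_dom c q /\ pos_parallel (gauss_at s c q) (gauss_at s c p).
Proof.
move=> Ac cp perp0; have [sm inj] := f_imm Ac.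
have op := @chart_cod_open _ _ c.
have Ux : (chart_map c @` chart_dom c) (chart_map c p) by exists p.
apply: filterI; first exact: near_chart_dom.
suff par : \forall y \near chart_map c p,
    pos_parallel (gauss (local_rep f c) s y) (gauss_at s c p).
  exact: chart_map_continuous cp _ par.
apply: (perp0_locally_parallel (dW := dgauss (local_rep f c) s)).
- exact: gauss_at_neq0.
- exact: (continuous_dotp_gauss op sm).
- apply: filterS (near_chart_cod cp) => y Uy v; split; last exact: perp0.
  exact: (is_derive_gauss op sm).
Qed.

(** The points whose Gauss vector has the direction found at p0 form a nonempty open and closed set.
    The choice of chart is immaterial by [gauss_at_transition]. *)
Lemma gauss_at_parallel c0 p0 : atlas c0 -> chart_dom c0 p0 ->
  (forall c, atlas c -> forall x v, (chart_map c @` chart_dom c) x ->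
     perp (gauss (local_rep f c) s x) (dgauss (local_rep f c) s x v) = 0) ->
  forall c p, atlas c -> chart_dom c p ->
  pos_parallel (gauss_at s c p) (gauss_at s c0 p0).
Proof.
move=> Ac0 cp0 perp0.
pose par c p := pos_parallel (gauss_at s c p) (gauss_at s c0 p0).
pose S := [set p | exists c, [/\ atlas c, chart_dom c p & par c p]].
have Spar c p : atlas c -> chart_dom c p -> S p -> par c p.
  move=> Ac cp [d [Ad dp]].
  exact: pos_parallel_trans (gauss_at_transition s Ac Ad cp dp).
have S_open : open S.
  rewrite openE => p [c [Ac cp pE]].
  apply: filterS (gauss_at_locally_parallel Ac cp (perp0 c Ac)).
  move=> q [cq qE]; exists c; split; [exact: Ac|exact: cq|].
  exact: pos_parallel_trans qE pE.
have S_closed : closed S.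
  rewrite -[S]setCK; apply: open_closedC; rewrite openE => p nSp.
  have [/(_ p)[c Ac cp] _] := @atlas_oriented _ N.
  apply: filterS (gauss_at_locally_parallel Ac cp (perp0 c Ac)).
  move=> q [cq qE] Sq; apply: nSp; exists c; split; [exact: Ac|exact: cp|].
  exact: pos_parallel_trans (pos_parallel_sym qE) (Spar c q Ac cq Sq).
have ST : S = setT.
  apply: (surface_connected (o := N)).
  - by exists p0, c0; split; [exact: Ac0|exact: cp0|exact: pos_parallel_refl].
  - by exists S => //; rewrite setTI.
  - by exists S => //; rewrite setTI.
by move=> c p Ac cp; apply: Spar => //; rewrite ST.
Qed.

Lemma minimal_slant_gauss u : minimal f -> dotp u u = 1 ->
  slant f (cs_mx s u) ->
  exists2 nu, dotp nu nu = 1 &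
    forall p E, positive_tangent_onb f p E -> row_wedge s E = nu.
Proof.
move=> fmin u1 [alpha _ u_slant].
(* On a surface without tangent frames, such as the empty one, any unit vector serves. *)
have [[p0 [E0 oE0]]|no_onb] :=
    pselect (exists p E, positive_tangent_onb f p E); last first.
  exists (row3 1 0 0); first by rewrite dotp3E !row3E; ring.
  by move=> p E oE; case: no_onb; exists p, E.
have perp0 c : atlas c -> forall x v, (chart_map c @` chart_dom c) x ->
    perp (gauss (local_rep f c) s x) (dgauss (local_rep f c) s x v) = 0.
  move=> Ac; have [sm inj] := f_imm Ac.
  apply: (minimal_constant_angle (@chart_cod_open _ _ c) sm inj s2
    (u := u) (C := cos alpha ^+ 2)) => // [|x [p cp <-]]; first exact: fmin.
  rewrite -/(gauss_at s c p) (alpha_slant_gauss u1 u_slant)// exprMn.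
  by rewrite sqr_sqrtr// dotp_ge0.
have [c0 [Ac0 cp0 E0E]] := positive_tangent_onb_gauss oE0.
exists (row_wedge s E0) => [|p E oE]; first exact: orthonormal_row_wedge oE0.1.
have [c [Ac cp EE]] := positive_tangent_onb_gauss oE.
apply: unit_pos_parallel_eq.
- exact: orthonormal_row_wedge oE.1.
- exact: orthonormal_row_wedge oE0.1.
- apply: pos_parallel_trans EE _.
  apply: pos_parallel_trans (pos_parallel_sym E0E).
  exact: gauss_at_parallel.
Qed.

(** The unit Gauss vector is a constant [nu], so the slant angle for v is the constant angle between
    v and [nu]. *)
Lemma minimal_slant u : minimal f -> dotp u u = 1 -> slant f (cs_mx s u) ->
  (forall alpha, 0 <= alpha <= pi ->
     exists2 v, dotp v v = 1 & alpha_slant f (cs_mx s v) alpha) /\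
  (forall v, dotp v v = 1 -> slant f (cs_mx s v)).
Proof.
move=> fmin u1 u_slant; have [nu nu1 nuE] := minimal_slant_gauss fmin u1 u_slant.
split=> [alpha alphaI|v v1].
  have [nu' nu'1 nunu'] := exists_orthogonal_unit nu.
  (* The point at angle alpha from [nu] on the great circle through [nu] and [nu']. *)
  exists (cos alpha *: nu + sin alpha *: nu').
    rewrite !(dotpDl, dotpDr, dotpZl, dotpZr) (dotpC nu' nu) nunu' nu1 nu'1.
    by rewrite -[RHS](cos2Dsin2 alpha); ring.
  move=> p E oE; rewrite plane_angle_cs_mx (nuE _ _ oE) dotpDl !dotpZl nu1.
  by rewrite dotpC nunu' mulr1 mulr0 addr0 cosK// in_itv.
exists (acos (dotp v nu)).
  by rewrite acos_ge0 ?acos_lepi ?dotp_unit_itv.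
by move=> p E oE; rewrite plane_angle_cs_mx (nuE _ _ oE).
Qed.

Lemma nonminimal_slant u v : ~ minimal f -> dotp u u = 1 -> dotp v v = 1 ->
  slant f (cs_mx s u) -> slant f (cs_mx s v) -> v = u \/ v = - u.
Proof.
move=> fmin u1 v1 [a _ u_slant] [b _ v_slant].
apply: unit_cross_eq0 => //; apply: contra_notP fmin => /eqP uv0 c Ac.
have [sm inj] := f_imm Ac.
apply: (two_angles_minimal (@chart_cod_open _ _ c) sm inj s2 u1 v1 uv0
    (k := cos a) (k' := cos b)) => x [p cp <-].
- exact: alpha_slant_gauss.
- exact: alpha_slant_gauss.
Qed.

Lemma signed_minimal_slant : minimal f ->
  (exists2 J, signed_cs s J & slant f J) ->
  (forall alpha, 0 <= alpha <= pi ->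
     exists2 J, signed_cs s J & alpha_slant f J alpha) /\
  (forall J, signed_cs s J -> slant f J).
Proof.
move=> fmin [_ /(signed_csP _ s2)[u u1 ->]] u_slant.
have [all_alpha all_J] := minimal_slant fmin u1 u_slant.
split=> [alpha /all_alpha[v v1 v_slant]|_ /(signed_csP _ s2)[v v1 ->]].
  by exists (cs_mx s v) => //; exact: signed_cs_mx.
exact: all_J.
Qed.

Lemma signed_nonminimal_slant : ~ minimal f ->
  exists2 J0, signed_cs s J0 &
    forall J, signed_cs s J -> slant f J -> J = J0 \/ J = - J0.
Proof.
move=> fmin.
have [[u [u1 u_slant]]|none] :=
    pselect (exists u, dotp u u = 1 /\ slant f (cs_mx s u)).
  exists (cs_mx s u); first exact: signed_cs_mx.
  move=> _ /(signed_csP _ s2)[v v1 ->] v_slant.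
  have [->|->] := nonminimal_slant fmin u1 v1 u_slant v_slant; first by left.
  by right; rewrite cs_mxN.
(* No structure of this sign is slant, so any of them can stand for [J0]. *)
exists (cs_mx s (row3 1 0 0)).
  by apply: signed_cs_mx => //; rewrite dotp3E !row3E; ring.
move=> _ /(signed_csP _ s2)[v v1 ->] v_slant.
by case: none; exists v.
Qed.

End Sign.
End Immersion.

Theorem theorem3p2 (R : realType) (N : oriented_surface R)
    (f : N -> 'rV[R]_4) (f_imm : immersion f) :
  (minimal f ->
     ((exists2 J : 'M[R]_4, Jplus J & slant f J) ->
        (forall alpha : R, 0 <= alpha <= pi ->
           exists2 J : 'M[R]_4, Jplus J & alpha_slant f J alpha) /\
        (forall J : 'M[R]_4, Jplus J -> slant f J)) /\
     ((exists2 J : 'M[R]_4, Jminus J & slant f J) ->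
        (forall alpha : R, 0 <= alpha <= pi ->
           exists2 J : 'M[R]_4, Jminus J & alpha_slant f J alpha) /\
        (forall J : 'M[R]_4, Jminus J -> slant f J))) /\
  (~ minimal f ->
     (exists2 J0 : 'M[R]_4, Jplus J0 &
        forall J : 'M[R]_4, Jplus J -> slant f J -> J = J0 \/ J = - J0) /\
     (exists2 J0 : 'M[R]_4, Jminus J0 &
        forall J : 'M[R]_4, Jminus J -> slant f J -> J = J0 \/ J = - J0)).
Proof.
have sN : (-1 : R) ^+ 2 = 1 by rewrite sqrrN expr1n.
have s1 : (1 : R) ^+ 2 = 1 by rewrite expr1n.
have plusE : @Jplus R = signed_cs 1.
  by apply/funext => J; apply/propext; exact: JplusE.
have minusE : @Jminus R = signed_cs (-1).
  by apply/funext => J; apply/propext; exact: JminusE.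
rewrite plusE minusE; split=> fmin; split.
- exact: signed_minimal_slant.
- exact: signed_minimal_slant.
- exact: signed_nonminimal_slant.
- exact: signed_nonminimal_slant.
Qed.
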